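(* Let $m\in\mathbb{Z}\setminus\{0,4\}$ with $m-4\notin\mathbb{Q}^{*2}$, let $\omega_1,\omega_2,\omega_3\in\mathbb{Z}_{\ge2}\cup\{\infty\}$ with some $\omega_i$ finite, and let $S(m)=\{p\in\Omega_{\mathbb{Q}} : m-4\in\mathbb{Q}_p^{*2}\}$ (where $\Omega_{\mathbb{Q}}$ is the set of places of $\mathbb{Q}$, $\mathbb{Q}_\infty=\mathbb{R}$). Then the Markoff orbifold pair $(\mathcal{X}_m,\mathcal{D}_{\underline\omega})$ fails strong approximation for semi-integral points off any finite set $T\subset S(m)$.
   Context: Fix $m\in\mathbb{Z}\setminus\{0,4\}$. Let $U_m\subset\mathbb{A}^3_{\mathbb{Q}}$ be $u_1^2+u_2^2+u_3^2-u_1u_2u_3=m$ with $\mathbb{Z}$-model $\mathcal{U}_m$ given by the same equation. Let $X_m\subset\mathbb{P}^3_{\mathbb{Q}}$ be $x_0(x_1^2+x_2^2+x_3^2)-x_1x_2x_3=mx_0^3$, with $\mathbb{Z}$-model $\mathcal{X}_m\subset\mathbb{P}^3_{\mathbb{Z}}$ given by the same equation; $U_m = X_m\cap\{x_0\neq0\}$ via $u_i=x_i/x_0$. The boundary $X_m\setminus U_m$ has irreducible components $D_i=\{x_0=x_i=0\}$, $i=1,2,3$; let $\mathcal{D}_i$ be the Zariski closure of $D_i$ in $\mathcal{X}_m$, and $\mathcal{D}_{\underline\omega}=\sum_i(1-1/\omega_i)\mathcal{D}_i$. Let $D_{\inf}=\bigcup_{\omega_i=\infty}D_i$, $\mathcal{D}_{\inf}=\bigcup_{\omega_i=\infty}\mathcal{D}_i$,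 $D_{i,\mathrm{fin}}=D_i\setminus D_{\inf}$, $\mathcal{D}_{i,\mathrm{fin}}=\mathcal{D}_i\setminus\mathcal{D}_{\inf}$. For a prime $p$, each point of $X_m(\mathbb{Q}_p)$ extends uniquely to $M_p:\mathrm{Spec}\,\mathbb{Z}_p\to\mathcal{X}_m$; write $\mathrm{Spec}\,\mathbb{Z}_p\times_{\mathcal{X}_m}\mathcal{D}_i=\mathrm{Spec}(\mathbb{Z}_p/I)$ and set $n_p(\mathcal{D}_i,M_p)=\infty$ if $I=0$, $=n$ if $I=(p^n)$. Local semi-integral points: $(\mathcal{X}_m,\mathcal{D}_{\underline\omega})^*(\mathbb{R})=(X_m\setminus D_{\inf})(\mathbb{R})$; for $p$ prime, $(\mathcal{X}_m,\mathcal{D}_{\underline\omega})^*(\mathbb{Z}_p)$ consists of $M_p\in(\mathcal{X}_m\setminus\mathcal{D}_{\inf})(\mathbb{Z}_p)$ with, for each $i$ with $\omega_i<\infty$, $n_p(\mathcal{D}_i,M_p)\in\mathbb{Z}_{\ge\omega_i}\cup\{0,\infty\}$ (Campana) resp. $\in\omega_i\mathbb{Z}_{\ge0}\cup\{\infty\}$ (Darmon); ''semi-integral'' means either notion. For a finite set $T$ of places, $\mathbb{Z}_T=\mathbb{Z}[1/p:p\in T\text{ prime}]$ and $(\mathcal{X}_m,\mathcal{D}_{\underline\omega})^*(\mathbb{Z}_T)$ is the set of $M\in X_m(\mathbb{Q})$ with $M\in(X_m\setminus D_{\inf})(\mathbb{Q}_v)$ for $v\in T\cup\{\infty\}$ and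 $M$ locally semi-integral at every prime $p\notin T$. The $T$-adelic semi-integral points are the disjoint union of the strict part $\prod_{v\in\{\infty\}\setminus T}U_m(\mathbb{R})\times\prod'_{p\notin T}\big((\mathcal{X}_m,\mathcal{D}_{\underline\omega})^*(\mathbb{Z}_p)\cap U_m(\mathbb{Q}_p)\big)$ (restricted product with respect to $\mathcal{U}_m(\mathbb{Z}_p)$, with the restricted product topology) and the non-strict part $\bigcup_{\omega_i<\infty}\big(\prod_{v\in\{\infty\}\setminus T}D_{i,\mathrm{fin}}(\mathbb{R})\times\prod_{p\notin T}((\mathcal{X}_m,\mathcal{D}_{\underline\omega})^*(\mathbb{Z}_p)\cap\mathcal{D}_{i,\mathrm{fin}}(\mathbb{Z}_p))\big)$ (with the product topology), endowed with the coproduct (''adelic'') topology. The pair satisfies strong approximation off $T$ if $(\mathcal{X}_m,\mathcal{D}_{\underline\omega})^*(\mathbb{Z}_T)$ is dense in the $T$-adelic semi-integral points for the adelic topology. *)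

(* Defs.v *)
From HB Require Import structures.
From mathcomp Require Import all_boot all_order all_algebra.
From mathcomp Require Import all_classical all_reals topology.

Set Implicit Arguments.
Unset Strict Implicit.
Unset Printing Implicit Defensive.

Import Order.TTheory GRing.Theory Num.Theory.

Local Open Scope classical_set_scope.
Local Open Scope ring_scope.

#[short(type="fieldTopologicalType")]
HB.structure Definition FieldTopological :=
  {K of GRing.Field K & Topological K}.

Definition prime_nat := {p : nat | prime p}.
Definition nat_of_prime (p : prime_nat) : nat := sval p.
Coercion nat_of_prime : prime_nat >-> nat.

Lemma prime_natP (p : prime_nat) : prime p. Proof. exact: (svalP p). Qed.

Lemma prime_nat_expn_gt0 (p : prime_nat) n : (0 < p ^ n)%N.
Proof. by rewrite expn_gt0 prime_gt0 // prime_natP. Qed.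

(* Inverse limit of the rings Z/p^n: the n-th entry is the canonical
   representative (in [0, p^n[) of the residue class modulo p^n. *)
Record padic_int (p : prime_nat) := PadicInt {
  residue :> nat -> nat;
  residueP : forall n, residue n = (residue n.+1 %% p ^ n)%N
}.

HB.instance Definition _ (p : prime_nat) := gen_eqMixin (padic_int p).
HB.instance Definition _ (p : prime_nat) := gen_choiceMixin (padic_int p).

Section PadicInt.
Variable p : prime_nat.
Implicit Types x y z : padic_int p.

Lemma padic_int_ext x y : residue x =1 residue y -> x = y.
Proof.
case: x y => [f Pf] [g Pg] /= /funext efg.
by rewrite {}efg in Pf *; congr PadicInt; exact: Prop_irrelevance.
Qed.

Lemma residue_mod x n : (x n %% p ^ n = x n)%N.
Proof. by rewrite (residueP x n) modn_mod. Qed.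

Lemma residue_le x n k : (x (n + k) %% p ^ n = x n)%N.
Proof.
elim: k => [|k IH]; first by rewrite addn0 residue_mod.
by rewrite -[RHS]IH (residueP x (n + k)%N) addnS modn_dvdm // dvdn_exp2l // leq_addr.
Qed.

Fact compat_modn (f : nat -> nat) :
  (forall n, f n = f n.+1 %[mod p ^ n]) ->
  forall n, (f n %% p ^ n = (f n.+1 %% p ^ n.+1) %% p ^ n)%N.
Proof. by move=> fP n; rewrite modn_dvdm ?dvdn_exp2l // fP. Qed.

Definition mk_padic f fP : padic_int p := PadicInt (@compat_modn f fP).

Fact padic_add_subproof x y n : (x n + y n = x n.+1 + y n.+1 %[mod p ^ n])%N.
Proof. by rewrite (residueP x) (residueP y) modnDm. Qed.
Definition padic_add x y := mk_padic (padic_add_subproof x y).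

Fact padic_mul_subproof x y n : (x n * y n = x n.+1 * y n.+1 %[mod p ^ n])%N.
Proof. by rewrite (residueP x) (residueP y) modnMm. Qed.
Definition padic_mul x y := mk_padic (padic_mul_subproof x y).

Fact padic_opp_subproof x n :
  (p ^ n - x n = p ^ n.+1 - x n.+1 %[mod p ^ n])%N.
Proof.
have lex k : (x k <= p ^ k)%N.
  by rewrite -(residue_mod x) ltnW // ltn_mod prime_nat_expn_gt0.
apply/eqP; rewrite -(eqn_modDr (x n.+1)) subnK ?lex //.
rewrite [X in _ == X %[mod _]]expnS modnMl.
by rewrite -modnDmr -(residueP x) subnK ?lex // modnn.
Qed.
Definition padic_opp x := mk_padic (padic_opp_subproof x).

Definition padic_nat (k : nat) := @mk_padic (fun=> k) (fun=> erefl).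

Fact padic_addA : associative padic_add.
Proof. by move=> x y z; apply: padic_int_ext => n /=; rewrite modnDmr modnDml addnA. Qed.
Fact padic_addC : commutative padic_add.
Proof. by move=> x y; apply: padic_int_ext => n /=; rewrite addnC. Qed.
Fact padic_add0 : left_id (padic_nat 0) padic_add.
Proof. by move=> x; apply: padic_int_ext => n /=; rewrite mod0n residue_mod. Qed.
Fact padic_addN : left_inverse (padic_nat 0) padic_opp padic_add.
Proof.
move=> x; apply: padic_int_ext => n /=; rewrite modnDml subnK ?modnn ?mod0n //.
by rewrite -(residue_mod x) ltnW // ltn_mod prime_nat_expn_gt0.
Qed.

HB.instance Definition _ := GRing.isZmodule.Build (padic_int p)
  padic_addA padic_addC padic_add0 padic_addN.

Fact padic_mulA : associative padic_mul.
Proof. by move=> x y z; apply: padic_int_ext => n /=; rewrite modnMmr modnMml mulnA. Qed.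
Fact padic_mulC : commutative padic_mul.
Proof. by move=> x y; apply: padic_int_ext => n /=; rewrite mulnC. Qed.
Fact padic_mul1 : left_id (padic_nat 1) padic_mul.
Proof. by move=> x; apply: padic_int_ext => n /=; rewrite modnMml mul1n residue_mod. Qed.
Fact padic_mulD : left_distributive padic_mul padic_add.
Proof.
by move=> x y z; apply: padic_int_ext => n /=; rewrite modnMml modnDm mulnDl.
Qed.
Fact padic_1neq0 : padic_nat 1 != 0.
Proof.
apply/eqP => /(congr1 (fun x : padic_int p => x 1%N)) /=.
by rewrite expn1 mod0n modn_small // prime_gt1 // prime_natP.
Qed.

HB.instance Definition _ := GRing.Zmodule_isComNzRing.Build (padic_int p)
  padic_mulA padic_mulC padic_mul1 padic_mulD padic_1neq0.

Definition padic_unit : {pred padic_int p} := [pred x | `[< exists y, y * x = 1 >]].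
Definition padic_inv x := xget x [set y | y * x = 1].

Fact padic_mulV : {in padic_unit, left_inverse 1 padic_inv *%R}.
Proof. by move=> x /asboolP ex; exact: (xgetPex x ex). Qed.
Fact padic_unitPl x y : y * x = 1 -> padic_unit x.
Proof. by move=> yx; apply/asboolP; exists y. Qed.
Fact padic_inv_out : {in [predC padic_unit], padic_inv =1 id}.
Proof.
move=> x /asboolPn nx; apply: xgetPN => y yx; apply: nx; by exists y.
Qed.

HB.instance Definition _ := GRing.ComNzRing_hasMulInverse.Build (padic_int p)
  padic_mulV padic_unitPl padic_inv_out.

Lemma padic_int_neq0 x : x != 0 -> exists n, ~~ (p ^ n %| x n)%N.
Proof.
move=> x0; apply: contrapT => /forallNP xn; case/eqP: x0.
apply: padic_int_ext => n; rewrite /= mod0n -(residue_mod x).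
by have /negP := xn n; rewrite negbK => /eqP.
Qed.

Fact padic_int_integral : GRing.integral_domain_axiom (padic_int p).
Proof.
move=> x y xy; apply/norP => -[/padic_int_neq0[a xa] /padic_int_neq0[b yb]].
have /= := congr1 (fun z : padic_int p => z (a + b)%N) xy.
rewrite mod0n => /eqP; rewrite -/(dvdn _ _) => dxy.
have dx : ~~ (p ^ a %| x (a + b))%N by rewrite /dvdn residue_le -(residue_mod x).
have dy : ~~ (p ^ b %| y (a + b))%N.
  by rewrite /dvdn addnC residue_le -(residue_mod y).
have x_gt0 : (0 < x (a + b))%N by rewrite lt0n; apply: contraNneq dx => ->.
have y_gt0 : (0 < y (a + b))%N by rewrite lt0n; apply: contraNneq dy => ->.
move: dx dy dxy; rewrite !pfactor_dvdn ?muln_gt0 ?x_gt0 ?prime_natP //.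
rewrite lognM // -!ltnNge => ltx lty; apply/negP; rewrite -ltnNge.
by rewrite -addnS leq_add // ltnW.
Qed.

HB.instance Definition _ :=
  GRing.ComUnitRing_isIntegral.Build (padic_int p) padic_int_integral.

Lemma natr_padic (k n : nat) : (k%:R : padic_int p) n = (k %% p ^ n)%N.
Proof.
elim: k => [|k IH] //; rewrite -natr1 /= IH modnDm addn1 //.
Qed.

Lemma natr_padic_eq0 (k : nat) : ((k%:R : padic_int p) == 0) = (k == 0)%N.
Proof.
apply/eqP/eqP => [k0|-> //].
have /= := congr1 (fun z : padic_int p => z k) k0.
rewrite natr_padic mod0n modn_small // ltn_expl // prime_gt1 // prime_natP //.
Qed.

End PadicInt.

Definition padic (p : prime_nat) := {fraction (padic_int p)}.
HB.instance Definition _ (p : prime_nat) := GRing.Field.on (padic p).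

Definition padic_of_int (p : prime_nat) : {rmorphism padic_int p -> padic p} :=
  @FracField.tofrac (padic_int p).

Section PadicTopology.
Variable p : prime_nat.

Definition padic_ball (x : padic p) (n : nat) : set (padic p) :=
  [set y | exists z : padic_int p, y - x = p%:R ^+ n * padic_of_int p z].

Definition padic_open : set_system (padic p) :=
  [set U | forall x, U x -> exists n, padic_ball x n `<=` U].

Lemma padic_ball_le (x : padic p) m n :
  (m <= n)%N -> padic_ball x n `<=` padic_ball x m.
Proof.
move=> lemn y [z yxz]; exists (p%:R ^+ (n - m) * z).
by rewrite yxz rmorphM rmorphXn rmorph_nat mulrA -exprD subnKC.
Qed.

Fact padic_openT : padic_open setT. Proof. by move=> x _; exists 0%N. Qed.
Fact padic_openI : setI_closed padic_open.
Proof.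
move=> U V oU oV x [/oU[m mU] /oV[n nV]]; exists (maxn m n) => y xy; split.
  by apply: mU; apply: padic_ball_le xy; exact: leq_maxl.
by apply: nV; apply: padic_ball_le xy; exact: leq_maxr.
Qed.
Fact padic_open_bigU (I : Type) (f : I -> set (padic p)) :
  (forall i, padic_open (f i)) -> padic_open (\bigcup_i f i).
Proof.
by move=> fP x [i _ /fP[n nf]]; exists n => y /nf fy; exists i.
Qed.
HB.instance Definition _ := isOpenTopological.Build (padic p)
  padic_openT padic_openI padic_open_bigU.

End PadicTopology.

Section PadicOfRat.
Variable p : prime_nat.

Lemma intr_padic_eq0 (k : int) : ((k%:~R : padic p) == 0) = (k == 0).
Proof.
have natr0 n : ((n%:R : padic p) == 0) = (n == 0)%N.
  by rewrite -(rmorph_nat (padic_of_int p)) tofrac_eq0 natr_padic_eq0.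
by case: k => n; rewrite ?NegzE ?rmorphN ?oppr_eq0 natr0.
Qed.

Definition padic_of_rat : rat -> padic p := ratr.

Let nz_den x : ((denq x)%:~R : padic p) != 0.
Proof. by rewrite intr_padic_eq0 denq_eq0. Qed.

Let injZtoQ : @injective rat int intr. Proof. exact: intr_inj. Qed.

Fact padic_of_rat_is_zmod_morphism : zmod_morphism padic_of_rat.
Proof.
move=> x y; rewrite /padic_of_rat.
apply: (canLR (mulfK (nz_den _))); apply: (mulIf (nz_den x)).
rewrite mulrAC mulrBl divfK ?nz_den // mulrAC -!rmorphM.
apply: (mulIf (nz_den y)); rewrite mulrAC mulrBl divfK ?nz_den //.
rewrite -!(rmorphM, rmorphB); congr _%:~R; apply: injZtoQ.
rewrite !(rmorphM, rmorphB) /= [_ - _]lock /= -lock !numqE.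
by rewrite (mulrAC y) -!mulrBl -mulrA mulrAC !mulrA.
Qed.

Fact padic_of_rat_is_monoid_morphism : monoid_morphism padic_of_rat.
Proof.
split=> [|x y]; first by rewrite /padic_of_rat /ratr divr1.
rewrite /padic_of_rat /ratr mulrC mulrAC.
apply: canLR (mulKf (nz_den _)) _; rewrite !mulrA.
do 2!apply: canRL (mulfK (nz_den _)) _; rewrite -!rmorphM; congr _%:~R.
apply: injZtoQ; rewrite !rmorphM [x * y]lock /= !numqE -lock.
by rewrite -!mulrA mulrA mulrCA -!mulrA (mulrCA y).
Qed.

HB.instance Definition _ := GRing.isZmodMorphism.Build rat (padic p)
  padic_of_rat padic_of_rat_is_zmod_morphism.
HB.instance Definition _ := GRing.isMonoidMorphism.Build rat (padic p)
  padic_of_rat padic_of_rat_is_monoid_morphism.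

End PadicOfRat.

HB.instance Definition _ (R : realType) := GRing.Field.on R^o.

(* [None] is the archimedean place. *)
Definition place := option prime_nat.

Definition completion (R : realType) (v : place) : fieldTopologicalType :=
  if v is Some p then padic p else R^o.

Definition rat_completion (R : realType) (v : place) :
    {rmorphism rat -> completion R v} :=
  match v with
  | Some p => @padic_of_rat p
  | None => @ratr R : {rmorphism rat -> R}
  end.

Definition primitive (A : comUnitRingType) : set 'rV[A]_4 :=
  [set a | exists i, a 0 i \is a GRing.unit].
Arguments primitive : clear implicits.

Section Proj3.
Variable A : comUnitRingType.

Definition proportional (a b : primitive A) : bool :=
  `[< exists2 c : A, c \is a GRing.unit & val a = c *: val b >].

Fact proportional_refl : reflexive proportional.
Proof. by move=> a; apply/asboolP; exists 1; rewrite ?unitr1 ?scale1r. Qed.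

Fact proportional_sym : symmetric proportional.
Proof.
by move=> a b; apply/asboolP/asboolP => -[c cU ->]; exists c^-1;
  rewrite ?unitrV // scalerA mulVr // scale1r.
Qed.

Fact proportional_trans : transitive proportional.
Proof.
move=> b a c /asboolP[s sU ab] /asboolP[t tU bc]; apply/asboolP.
by exists (s * t); rewrite ?unitrM ?sU ?tU // ab bc scalerA.
Qed.

Canonical proportional_equiv := EquivRel proportional
  proportional_refl proportional_sym proportional_trans.

(* P^3(A), for A a local ring (in particular a field or Z_p): the vectors with
   an invertible coordinate, up to multiplication by a unit. *)
Definition proj3 := {eq_quot proportional}%qT.
HB.instance Definition _ := Choice.on proj3.

Definition proj3_of (a : primitive A) : proj3 := (\pi a)%qT.

(* Well defined up to a unit, like every condition stated with it below *)
Definition hcoord (x : proj3) : 'rV[A]_4 := val (repr x : primitive A).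

End Proj3.

Lemma primitive_map (A B : comUnitRingType) (f : {rmorphism A -> B})
  (a : 'rV[A]_4) : primitive A a -> primitive B (map_mx f a).
Proof. by case=> i ai; exists i; rewrite mxE rmorph_unit. Qed.

Definition proj3_map (A B : comUnitRingType) (f : {rmorphism A -> B})
    (x : proj3 A) : proj3 B :=
  proj3_of (SigSub (mem_set (primitive_map f (set_valP (repr x))))).

(* P^3(K), K a topological field, carries the quotient of the topology of
   K^4 \ {0}. *)
Section Proj3Topology.
Variable K : fieldTopologicalType.

Definition proj3_open : set_system (proj3 K) :=
  [set W | open (@proj3_of K @^-1` W)].

Fact proj3_openT : proj3_open setT. Proof. exact: openT. Qed.
Fact proj3_openI : setI_closed proj3_open.
Proof. by move=> U V oU oV; exact: openI. Qed.
Fact proj3_open_bigU (I : Type) (f : I -> set (proj3 K)) :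
  (forall i, proj3_open (f i)) -> proj3_open (\bigcup_i f i).
Proof. by move=> fP; apply: bigcup_open => i _; exact: fP. Qed.

HB.instance Definition _ := isOpenTopological.Build (proj3 K)
  proj3_openT proj3_openI proj3_open_bigU.

End Proj3Topology.

(* The coordinate x_{i+1}, for i in {0, 1, 2}. *)
Definition coord_index (i : 'I_3) : 'I_4 := lift ord0 i.

Section Markoff.
Variables (m : int) (A : comUnitRingType).

Definition affine_markoff (u : 'rV[A]_3) : Prop :=
  \sum_i u 0 i ^+ 2 - \prod_i u 0 i = m%:~R.

Definition markoff_points : set (proj3 A) :=
  [set x | let a := hcoord x in
    a 0 ord0 * (\sum_i a 0 (coord_index i) ^+ 2) - \prod_i a 0 (coord_index i)
    = m%:~R * a 0 ord0 ^+ 3].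

(* U_m(A), for A a field *)
Definition open_points : set (proj3 A) :=
  markoff_points `&` [set x | hcoord x 0 ord0 != 0].

(* D_{i+1}(A). Over the integers, the Zariski closure of the line
   x_0 = x_{i+1} = 0 of P^3_Q is the subscheme of P^3_Z with the same equations
   (it is integral, and flat over Z), so this is also the set of A-valued points
   of the closure. *)
Definition boundary_points (i : 'I_3) : set (proj3 A) :=
  [set x | hcoord x 0 ord0 = 0 /\ hcoord x 0 (coord_index i) = 0].

Fact primitive_affine (u : 'rV[A]_3) : primitive A (row_mx 1%:M u).
Proof.
have e : @row_mx A 1 1 3 1%:M u 0 (lshift 3 ord0) = 1.
  by rewrite row_mxEl mxE eqxx.
exists (@lshift 1 3 ord0).
exact: (@eq_ind_r _ _ (fun z : A => z \is a GRing.unit) (unitr1 A) _ e).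
Qed.

(* u |-> [1 : u_1 : u_2 : u_3] *)
Definition affine_point (u : 'rV[A]_3) : proj3 A :=
  proj3_of (SigSub (mem_set (primitive_affine u))).

End Markoff.
Arguments markoff_points : clear implicits.
Arguments open_points : clear implicits.
Arguments boundary_points : clear implicits.

(* Weights and intersection multiplicities are in [option nat], where [None]
   stands for infinity. *)

Variant semi_integral_kind := Campana | Darmon.

Definition allowed_multiplicity (kind : semi_integral_kind) (w : nat)
    (n : option nat) : Prop :=
  if n is Some k then
    match kind with
    | Campana => k = 0%N \/ (w <= k)%N
    | Darmon => (w %| k)%N
    end
  else True.

Section LocalPoints.
Variables (m : int) (omega : 'I_3 -> option nat) (kind : semi_integral_kind).
Variable p : prime_nat.
Local Notation Zp := (padic_int p).
Local Notation Qp := (padic p).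

(* The ideal I such that Spec(Z_p) x_X D_{i+1} = Spec(Z_p / I) *)
Definition boundary_ideal (i : 'I_3) (M : proj3 Zp) : set Zp :=
  [set z | exists s t : Zp,
    z = s * hcoord M 0 ord0 + t * hcoord M 0 (coord_index i)].

(* n_p(D_{i+1}, M) = n *)
Definition boundary_multiplicity (i : 'I_3) (M : proj3 Zp) (n : option nat) :=
  boundary_ideal i M =
    if n is Some k then [set z | exists s : Zp, z = s * p%:R ^+ k]
    else [set 0].

(* M : Spec(Z_p) -> X_m avoids the closed subset D_inf, on both fibres, iff the
   corresponding ideals are all of Z_p. *)
Definition avoids_Dinf (M : proj3 Zp) : Prop :=
  forall j, omega j = None -> boundary_multiplicity j M (Some 0%N).

Definition semi_integral_Zp : set (proj3 Qp) :=
  [set proj3_map (padic_of_int p) M | M in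
    [set M : proj3 Zp | [/\ markoff_points m Zp M, avoids_Dinf M &
      forall i w, omega i = Some w ->
        exists2 n, boundary_multiplicity i M n & allowed_multiplicity kind w n]]].

(* D_{i+1,fin}(Z_p) *)
Definition boundary_fin_Zp (i : 'I_3) : set (proj3 Qp) :=
  [set proj3_map (padic_of_int p) M | M in
    [set M : proj3 Zp | boundary_points Zp i M /\ avoids_Dinf M]].

(* The integral model of U_m, as a subset of X_m(Q_p) *)
Definition affine_Zp : set (proj3 Qp) :=
  [set proj3_map (padic_of_int p) (affine_point u) | u in
    [set u : 'rV[Zp]_3 | affine_markoff m u]].

End LocalPoints.
Arguments semi_integral_Zp : clear implicits.
Arguments boundary_fin_Zp : clear implicits.
Arguments affine_Zp : clear implicits.

Definition off_Dinf (omega : 'I_3 -> option nat) (K : fieldType) :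
    set (proj3 K) :=
  [set x | forall j, omega j = None -> ~ boundary_points K j x].
Arguments off_Dinf : clear implicits.

Section Adelic.
Variables (R : realType) (m : int) (omega : 'I_3 -> option nat).
Variable kind : semi_integral_kind.

Definition strict_local (v : place) : set (proj3 (completion R v)) :=
  match v with
  | Some p => semi_integral_Zp m omega kind p `&` open_points m (padic p)
  | None => open_points m R^o
  end.

(* The value at the archimedean place is irrelevant, since the restricted product
   only involves these sets at all but finitely many places. *)
Definition integral_local (v : place) : set (proj3 (completion R v)) :=
  match v with
  | Some p => affine_Zp m p
  | None => open_points m R^o
  end.

Definition nonstrict_local (i : 'I_3) (v : place) :
    set (proj3 (completion R v)) :=
  match v with
  | Some p => semi_integral_Zp m omega kind p `&` boundary_fin_Zp omega p i
  | None => boundary_points R^o i `&` off_Dinf omega R^o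
  end.

Arguments strict_local : clear implicits.
Arguments integral_local : clear implicits.
Arguments nonstrict_local : clear implicits.

Variable T : set place.

Definition place_off := set_type (~` T).

(* P^3(Q_v), with the quotient of the v-adic topology *)
Definition local_points (v : place_off) : topologicalType :=
  proj3 (completion R (val v)).

Definition local_families := forall v : place_off, local_points v.
HB.instance Definition _ :=
  Topological.copy local_families (prod_topology local_points).

Definition strict_families : set local_families :=
  [set x | (forall v, strict_local (val v) (x v)) /\
           finite_set [set v | ~ integral_local (val v) (x v)]].

Definition nonstrict_families : set local_families :=
  [set x | exists2 i, omega i <> None & forall v, nonstrict_local i (val v) (x v)].

Definition strict_part := set_type strict_families.
HB.instance Definition _ := Choice.on strict_part.

Definition restricted_box
    (B : forall v : place_off, set (local_points v)) : Prop :=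
  (forall v, exists2 W, open W & B v = strict_local (val v) `&` W) /\
  finite_set [set v | B v <> integral_local (val v)].

(* Restricted product topology. The boxes form a base, and not just a subbase,
   since the integral points are open in the strict local points. *)
HB.instance Definition _ := @isSubBaseTopological.Build strict_part
  (set strict_part)
  [set O | exists2 B, restricted_box B &
             O = [set x | forall v, B v (set_val x v)]]
  id.

Definition nonstrict_part : topologicalType := set_type nonstrict_families.

(* Coproduct of the strict part ([true]) and of the non-strict part ([false]) *)
Definition adelic_part (b : bool) : topologicalType :=
  if b then (strict_part : topologicalType) else nonstrict_part.
Definition adelic_points : topologicalType := {b : bool & adelic_part b}.

Definition adelic_coord (x : adelic_points) : local_families :=
  match x with
  | existT true y => set_val (y : strict_part)
  | existT false y => set_val (y : nonstrict_part)
  end.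

Definition rational_at (v : place) (M : proj3 rat) : proj3 (completion R v) :=
  proj3_map (rat_completion R v) M.

Definition semi_integral_ZT : set (proj3 rat) :=
  [set M | [/\ markoff_points m rat M,
    forall v : place, T v \/ v = None ->
      off_Dinf omega (completion R v) (rational_at v M) &
    forall p : prime_nat, ~ T (Some p) ->
      semi_integral_Zp m omega kind p (rational_at (Some p) M)]].

Definition strong_approximation : Prop :=
  dense [set x : adelic_points | exists2 M, semi_integral_ZT M &
    forall v, adelic_coord x v = rational_at (val v) M].

End Adelic.

(* S(m) *)
Definition split_places (R : realType) (m : int) : set place :=
  [set v | exists2 x : completion R v, x != 0 & x ^+ 2 = (m - 4)%:~R].

(* Main.v *)
From mathcomp Require Import all_boot all_order all_algebra.
From mathcomp Require Import all_solvable all_field all_character.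
From mathcomp Require Import all_classical all_reals topology.
From mathcomp Require Import zify ring lra generic_quotient.
Require Import Defs.
Set Implicit Arguments.
Unset Strict Implicit.
Unset Printing Implicit Defensive.
Import Order.TTheory GRing.Theory Num.Theory.
Local Open Scope classical_set_scope.
Local Open Scope ring_scope.

(** Write [m - 4 = f^2 d] with [d] squarefree, and fix [i] with [omega_i] finite.
    The identity
      [m - 4 = (u_i - 2) (u_i + 2 - u_j u_l) + (u_j - u_l)^2]
    shows that at an integral point any prime dividing [a = u_i - 2] splits in
    [Q(sqrt d)], apart from finitely many primes: this is the quaternion algebra
    [(u_i - 2, m - 4)], which is unramified along [D_i] but takes both values there.

    Indeed, on the conic [u_i = k + 1/k] we have [a = (k - 1)^2 / k], and this conic
    contains rational points that are [p]-adically close to [D_i], hence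
    semi-integral.  Let [chi] be the quadratic character of [Q(sqrt d)], of
    conductor [D], and [chi k = -1].  Consider the adelic open set of the points
    with [a] close to [(k - 1)^2 / k] at the primes dividing [D], with [a] of even
    valuation at the other bad primes, with [a > 0] at the real place, and integral
    at all other primes.  It is not empty.  For a rational point in it, the product
    over the primes not dividing [D] of [chi p ^ v_p(a)] is [1], the primes of [T]
    being split, while reading [a] modulo [D] gives [chi k = -1] for the same product.

    The character comes from [sqrt d] lying in the ring generated by the roots of
    unity of order [D]: [chi k] is the sign by which the automorphism
    [zeta |-> zeta^k] acts on [sqrt d], and the Frobenius congruence shows
    [chi p = 1] for split [p]. *)

(** * Quadratic characters *)

(* The ring generated by the roots of unity of order dividing [D]. *)
Inductive Zmu (D : nat) : algC -> Prop :=
| Zmu_root z of z ^+ D = 1 : Zmu D z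
| Zmu_opp x of Zmu D x : Zmu D (- x)
| Zmu_add x y of Zmu D x & Zmu D y : Zmu D (x + y)
| Zmu_mul x y of Zmu D x & Zmu D y : Zmu D (x * y).

Lemma Zmu1 D : Zmu D 1. Proof. by apply: Zmu_root; rewrite expr1n. Qed.

Lemma Zmu_dvd D D' x : (D %| D')%N -> Zmu D x -> Zmu D' x.
Proof.
move=> /dvdnP[c ->]; elim=> {x} [z zD|x _|x y _ + _|x y _ + _].
- by apply: Zmu_root; rewrite mulnC exprM zD expr1n.
- exact: Zmu_opp.
- exact: Zmu_add.
- exact: Zmu_mul.
Qed.

Lemma Zmu_prod D (I : Type) (r : seq I) (P : pred I) F :
  (forall i, P i -> Zmu D (F i)) -> Zmu D (\prod_(i <- r | P i) F i).
Proof. by move=> h; apply: big_ind => //; [exact: Zmu1 | exact: Zmu_mul]. Qed.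

Lemma Zmu_Aint D x : (0 < D)%N -> Zmu D x -> x \in Aint.
Proof.
move=> D0; elim=> {x} [z zD|x _|x y _ hx _ hy|x y _ hx _ hy].
- by apply: (Aint_unity_root D0); apply/unity_rootP.
- by rewrite rpredN.
- by rewrite rpredD.
- by rewrite rpredM.
Qed.

Lemma Zmu_eq_aut D (u v : {rmorphism algC -> algC}) x :
  (forall z, z ^+ D = 1 -> u z = v z) -> Zmu D x -> u x = v x.
Proof.
move=> uv; elim=> {x} [z /uv //|x _|x y _ hx _ hy|x y _ hx _ hy].
- by rewrite !rmorphN => ->.
- by rewrite !rmorphD hx hy.
- by rewrite !rmorphM hx hy.
Qed.

Lemma eqAmod_exprDp (p : nat) (x y : algC) : prime p -> x \in Aint -> y \in Aint ->
  ((x + y) ^+ p == x ^+ p + y ^+ p %[mod p])%A.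
Proof.
move=> pp xA yA; case: p pp => // p pp.
rewrite exprDn big_ord_recl big_ord_recr /= subn0 subnn !expr0 mulr1 mul1r.
rewrite bin0 binn !mulr1n eqAmodDl -[X in (_ == X %[mod _])%A]add0r.
rewrite eqAmodDr eqAmod0; apply: rpred_sum => i _.
have /dvdnP[c ->] : (p.+1 %| 'C(p.+1, bump 0 i))%N.
  by apply: prime_dvd_bin => //; rewrite /bump /= add1n ltnS /=; exact: ltn_ord.
rewrite -mulr_natr natrM mulrA -eqAmod0; apply: eqAmodMl0.
by rewrite rpredM ?rpred_nat // rpredM ?rpredX.
Qed.

Lemma eqAmodX (e : nat) n x y : x \in Aint -> y \in Aint ->
  (x == y %[mod e])%A -> (x ^+ n == y ^+ n %[mod e])%A.
Proof.
move=> xA yA xy; elim: n => [|n IH]; first by rewrite !expr0 eqAmod_refl.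
by rewrite !exprS eqAmodM ?rpredX.
Qed.

(** Modulo [p] both sides are additive and multiplicative in [x], and they agree on the roots of
    unity. That [p] is odd takes care of opposites. *)
Lemma Zmu_frobenius D (p : nat) (u : {rmorphism algC -> algC}) x :
  (0 < D)%N -> prime p -> odd p -> (forall z, z ^+ D = 1 -> u z = z ^+ p) ->
  Zmu D x -> (u x == x ^+ p %[mod p])%A.
Proof.
move=> D0 pp op uz; elim=> {x} [z /uz -> //|x _|x y hx ux hy uy|x y hx ux hy uy].
- by rewrite rmorphN exprNn -signr_odd op expr1 mulN1r eqAmodN opprK.
- rewrite rmorphD; apply: eqAmod_trans (_ : x ^+ p + y ^+ p == _ %[mod p])%A.
    exact: eqAmodD.
  by rewrite eqAmod_sym; apply: eqAmod_exprDp (Zmu_Aint D0 hx) (Zmu_Aint D0 hy).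
- rewrite rmorphM exprMn; apply: eqAmodM => //.
    by rewrite Aint_aut (Zmu_Aint D0 hx).
  by rewrite rpredX // (Zmu_Aint D0 hy).
Qed.

(** * Square roots of integers in cyclotomic rings *)

Lemma prod_1subX (n : nat) (w : algC) : n.-primitive_root w ->
  \prod_(1 <= j < n) (1 - w ^+ j) = n%:R.
Proof.
move=> pw; have n0 := prim_order_gt0 pw.
(* Cancel [X - 1] in the factorization of [X^n - 1] and evaluate at 1. *)
have := factor_Xn_sub_1 pw; rewrite big_ltn // expr0 subrX1.
move/(mulfI (negbT (polyXsubC_eq0 _))) => /(congr1 (fun q => q.[1])).
rewrite horner_prod; under eq_bigr do rewrite hornerXsubC.
move=> ->; rewrite horner_sum; under eq_bigr do rewrite hornerXn expr1n.
by rewrite sumr_const card_ord.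
Qed.

(* The square root is [prod_j (z^j - z^-j)], as [p = prod_j (1 - z^(2 j))]. *)
Lemma sqrt_prime_Zmu (p : nat) : prime p -> odd p ->
  exists2 x, Zmu p x & x ^+ 2 = (-1) ^+ p./2 * p%:R.
Proof.
move=> pp op; have [z pz] := C_prim_root_exists (prime_gt0 pp).
have pw : p.-primitive_root (z ^+ 2).
  by rewrite (prim_root_exp_coprime _ pz) coprime2n.
have zp : z ^+ p = 1 by exact: prim_expr_order.
exists (\prod_(1 <= j < p./2.+1) (z ^+ j - z ^+ (p - j))).
  apply: Zmu_prod => j _; apply: Zmu_add; last apply: Zmu_opp;
    by apply: Zmu_root; rewrite exprAC zp expr1n.
have ep : p = p./2.*2.+1 by rewrite -[LHS]odd_double_half op.
have le1 : (p./2 < p)%N by lia.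
(* The upper half of the product is reversed, so that [j] gets paired with [p - j]. *)
have prodE : p%:R = \prod_(1 <= j < p./2.+1) (1 - (z ^+ 2) ^+ j) *
    \prod_(p./2.+1 <= i < p) (1 - (z ^+ 2) ^+ (p./2.+1 + p - i.+1)) :> algC.
  by rewrite -(prod_1subX pw) (big_cat_nat _ (n := p./2.+1)) //= [X in _ * X]big_nat_rev.
have e1 : \prod_(p./2.+1 <= i < p) (1 - (z ^+ 2) ^+ (p./2.+1 + p - i.+1)) =
          \prod_(1 <= i < p./2.+1) (1 - (z ^+ 2) ^+ (p - i)) :> algC.
  rewrite -{1}[p./2.+1]add1n big_addn.
  have -> : (p - p./2 = p./2.+1)%N by lia.
  apply: eq_big_nat => i /andP[i1 i2]; congr (1 - _ ^+ _); lia.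
rewrite prodE e1 -big_split /= -prodrXl -[in (-1) ^+ _](@subn0 p./2) -subSS.
rewrite -prodr_const_nat -big_split /=; apply: eq_big_nat => j /andP[j1 j2].
have jp : (j <= p)%N by lia.
have hz : z ^+ j * z ^+ (p - j) = 1 by rewrite -exprD subnKC.
rewrite -!exprM ![(2 * _)%N]mulnC !exprM.
move: (z ^+ j) (z ^+ (p - j)) hz => a b hab.
(* As [a * b = 1], one has [(a - b)^2 = - (1 - a^2) (1 - b^2)]: each of the [(p - 1) / 2] pairs
   contributes one sign. *)
have -> : (a - b) ^+ 2 = a ^+ 2 + b ^+ 2 - 2 * (a * b) by ring.
have -> : -1 * ((1 - a ^+ 2) * (1 - b ^+ 2)) = a ^+ 2 + b ^+ 2 - 1 - (a * b) ^+ 2 by ring.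
by rewrite hab; ring.
Qed.

Definition squarefree (d : int) := forall p : nat, prime p -> ~~ (p ^ 2 %| `|d|)%N.

Lemma squarefree_part (d : int) : d != 0 ->
  exists f d0 : int, [/\ d = f ^+ 2 * d0, d0 != 0 & squarefree d0].
Proof.
have [n] := ubnP `|d|%N; elim: n d => // n IH d dn d0.
have [[p pp pd]|nsf] := pselect (exists2 p, prime p & (p ^ 2 %| `|d|)%N); last first.
  exists 1, d; split=> //; first by rewrite expr1n mul1r.
  by move=> p pp; apply/negP => pd; apply: nsf; exists p.
have /dvdzP[c ec] : ((p ^ 2)%N%:Z %| d)%Z by [].
have c0 : c != 0 by apply: contraNneq d0 => c0; rewrite ec c0 mul0r.
have cn : (`|c| < n)%N.
  apply: leq_trans (_ : `|d| <= n)%N; last by [].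
  rewrite ec abszM absz_nat ltn_Pmulr ?absz_gt0 //.
  by rewrite (ltn_exp2l 0) // prime_gt1.
have [f [e [ef e0 sf]]] := IH c cn c0.
exists (p%:Z * f), e; split=> //; rewrite ec ef -mulnn PoszM; ring.
Qed.

Lemma squarefree_dvd (d e : int) : squarefree (e * d) -> squarefree d.
Proof.
move=> sf p pp; apply: contra (sf p pp) => h.
by rewrite abszM dvdn_mull.
Qed.

(** Dividing [d] by this signed prime keeps its class modulo 4, which decides whether 2 may divide
    the conductor. *)
Lemma signed_prime_mod4 (p : nat) : odd p -> exists t : int, (-1) ^+ p./2 * p%:Z = 4 * t + 1.
Proof.
move=> op; have ep : p = p./2.*2.+1 by rewrite -[LHS]odd_double_half op.
rewrite -signr_odd; case E: (odd p./2).
  by exists (- (p./2./2)%:Z - 1); rewrite expr1; lia.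
by exists (p./2./2)%:Z; rewrite expr0; lia.
Qed.

(** For [z] a primitive eighth root of unity, [z^4 = -1], so [z + z^-1] has square 2 and [z + z^3]
    has square -2. *)
Lemma sqrt_two_Zmu : (exists2 x, Zmu 8 x & x ^+ 2 = 2) /\ (exists2 x, Zmu 8 x & x ^+ 2 = - 2).
Proof.
have [z pz] := @C_prim_root_exists 8 isT.
have z8 : z ^+ 8 = 1 by exact: prim_expr_order.
have z4 : z ^+ 4 = -1.
  have : (z ^+ 4) ^+ 2 == 1 ^+ 2 by rewrite -exprM z8 expr1n.
  rewrite eqf_sqr => /orP[|/eqP //]; rewrite -(prim_order_dvd pz) //.
have hr k : Zmu 8 (z ^+ k) by apply: Zmu_root; rewrite exprAC z8 expr1n.
split.
  exists (z + z ^+ 7); first by apply: Zmu_add; [exact: (hr 1) | exact: hr].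
  have -> : (z + z ^+ 7) ^+ 2 = z ^+ 2 + 2 * z ^+ 8 + z ^+ 2 * (z ^+ 4) * z ^+ 8 by ring.
  by rewrite z8 z4; ring.
exists (z + z ^+ 3); first by apply: Zmu_add; [exact: (hr 1) | exact: hr].
have -> : (z + z ^+ 3) ^+ 2 = z ^+ 2 + 2 * z ^+ 4 + z ^+ 2 * (z ^+ 4) by ring.
by rewrite z4; ring.
Qed.

(** Induction on [|d|], dividing by the signed prime of an odd prime factor until [|d|] is 1 or 2.
    The last clause controls ramification: [D] is odd when [d] is 1 modulo 4. *)
Lemma sqrt_Zmu (d : int) : d != 0 -> squarefree d ->
  exists D x, [/\ (0 < D)%N, Zmu D x, x ^+ 2 = d%:~R &
    forall p, prime p -> (p %| D)%N ->
      (p %| `|d|)%N \/ p = 2%N /\ forall t, d != 4 * t + 1].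
Proof.
have [n] := ubnP `|d|%N; elim: n d => // n IH d dn d0 sf.
have [[/eqP d1|/eqP d2]|] : ((`|d| == 1) \/ (`|d| == 2))%N \/ ~~ ((`|d| == 1) || (`|d| == 2))%N.
  by case: (`|d|%N == 1%N); case: (`|d|%N == 2%N); auto.
- have [->|->] : d = 1 \/ d = -1 by lia.
    exists 1%N, 1; split=> //; first exact: Zmu1; first by rewrite expr1n.
    by move=> p pp; rewrite dvdn1 => /eqP p1; rewrite p1 in pp.
  exists 4, 'i; split=> //.
  + by apply: Zmu_root; rewrite (exprM _ 2 2) sqrCi sqrrN expr1n.
  + by rewrite sqrCi.
  + move=> p pp p4; have : (p %| 2 ^ 2)%N by [].
    rewrite Euclid_dvdX // dvdn_prime2 // => /andP[/eqP -> _].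
    by right; split=> // t; apply/eqP; lia.
- have h8 p : prime p -> (p %| 8)%N -> (p %| `|d|)%N.
    move=> pp p8; have : (p %| 2 ^ 3)%N by [].
    by rewrite Euclid_dvdX // d2 => /andP[].
  have [[x hx ex] [y hy ey]] := sqrt_two_Zmu.
  have [ed|ed] : d = 2 \/ d = -2 by lia.
    exists 8, x; split=> //; first by rewrite ex ed.
    by move=> p pp /h8 -/(_ pp); left.
  exists 8, y; split=> //; first by rewrite ey ed.
  by move=> p pp /h8 -/(_ pp); left.
rewrite negb_or => /andP[nd1 nd2].
(* Without an odd prime factor, a squarefree [d] would be 1 or 2 up to sign. *)
have [p [pp op pd]] : exists p : nat, [/\ prime p, odd p & (p %| `|d|)%N].
  have [p0|o] := boolP (2 %| `|d|)%N; last first.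
    exists (pdiv `|d|%N); rewrite pdiv_prime ?pdiv_dvd; last by lia.
    split=> //; rewrite -[odd _]negbK -dvdn2; apply: contra o => /dvdn_trans; apply; exact: pdiv_dvd.
  case/dvdnP: p0 => c ec; have oc : ~~ (2 %| c)%N.
    apply: contra (sf 2%N isT) => hc; rewrite ec mulnC (_ : 2 ^ 2 = 2 * 2)%N //.
    exact: dvdn_mul.
  exists (pdiv c); rewrite pdiv_prime; last by lia.
  split=> //; last by rewrite ec dvdn_mulr // pdiv_dvd.
  rewrite -[odd _]negbK -dvdn2; apply: contra oc => /dvdn_trans; apply; exact: pdiv_dvd.
pose ps : int := (-1) ^+ p./2 * p%:Z.
have [t et] := signed_prime_mod4 op.
have [d' ed] : exists d', d = ps * d'.
  have /dvdzP[c ec] : (p%:Z %| d)%Z by [].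
  exists ((-1) ^+ p./2 * c); rewrite /ps ec mulrACA -expr2 sqrr_sign; ring.
have d'0 : d' != 0 by apply: contraNneq d0 => e; rewrite ed e mulr0.
have aps : `|ps|%N = p by rewrite /ps abszMsign.
have sf' : squarefree d' by apply: (@squarefree_dvd _ ps); rewrite -ed.
have ad : `|d|%N = (p * `|d'|)%N by rewrite ed abszM aps.
have p1 := prime_gt1 pp.
have dn' : (`|d'| < n)%N.
  apply: leq_trans (_ : `|d| <= n)%N; last by [].
  by rewrite ad ltn_Pmull // absz_gt0.
have [D [x [D0 hx ex hD]]] := IH d' dn' d'0 sf'.
have [y hy ey] := sqrt_prime_Zmu pp op.
exists (p * D)%N, (y * x); split.
- by rewrite muln_gt0 D0 prime_gt0.
- apply: Zmu_mul; first exact: Zmu_dvd (dvdn_mulr _ _) hy.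
  exact: Zmu_dvd (dvdn_mull _ _) hx.
- by rewrite exprMn ex ey ed /ps !rmorphM rmorphXn rmorphN rmorph1.
- move=> q pq; rewrite Euclid_dvdM // => /orP[qp|qD].
    by left; apply: dvdn_trans qp pd.
  case: (hD q pq qD) => [qd|[-> h]]; first by left; rewrite ad dvdn_mull.
  right; split=> // s; apply/eqP => es; have /eqP := h (s - t * d'); apply.
  have : (4 * t + 1) * d' = 4 * s + 1 by rewrite -es ed /ps et.
  by lia.
Qed.

(** * Construction of the quadratic character *)

Lemma eqAmod0_int (e : nat) (z : int) : (z%:~R == 0 %[mod e])%A = (e%:Z %| z)%Z.
Proof.
rewrite eqAmod0_rat ?rpred_nat ?rpred_int //.
by rewrite dvdC_int // intrKfloor.
Qed.

(* [chi k = true] stands for the value [-1]; the values at [k] not coprime to [D]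
   are irrelevant. *)
Record quadratic_character (d : int) (D : nat) (chi : nat -> bool) : Prop := {
  qchar_gt0 : (0 < D)%N;
  qcharM : forall k l, coprime k D -> coprime l D -> chi (k * l)%N = chi k (+) chi l;
  qchar_mod : forall k l, coprime k D -> k = l %[mod D] -> chi k = chi l;
  qchar_opp : 0 < d -> forall k l, coprime k D -> (D %| k + l)%N -> chi k = chi l;
  qchar_split : forall p s f : nat, prime p -> odd p -> ~~ (p %| `|d|)%N ->
    ~~ (p %| f)%N -> (p%:Z %| s%:Z ^+ 2 - f%:Z ^+ 2 * d)%Z ->
    coprime p D /\ chi p = false;
  qchar_dvd : forall p, prime p -> (p %| D)%N ->
    (p %| `|d|)%N \/ p = 2%N /\ forall t, d != 4 * t + 1;
  qchar_nontrivial : exists2 k, coprime k D & chi k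
}.

(** The fields reflect properties of the automorphisms [zeta |-> zeta^k]: composition gives
    multiplicativity, complex conjugation the value at -1, Frobenius the value at split primes,
    Galois theory the non-triviality. *)
Lemma quadratic_character_exists (d : int) : d != 0 -> squarefree d ->
  (forall s : int, s ^+ 2 != d) -> exists D chi, quadratic_character d D chi.
Proof.
move=> d0 sf nsq; have [D [x [D0 hx ex hD]]] := sqrt_Zmu d0 sf.
have x0 : x != 0 by apply: contraNneq d0 => x0; rewrite -(intr_eq0 algC) -ex x0 expr0n.
have x2 : x + x != 0 by rewrite -mulr2n mulrn_eq0.
have nx : (- x == x) = false by rewrite eq_sym -addr_eq0 (negbTE x2).
pose chi k := if @idP (coprime k D) is ReflectT h then sval (Qn_aut_exists h) x != x else false.
have ux (u : {rmorphism algC -> algC}) : u x = x \/ u x = - x.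
  have : (u x) ^+ 2 == x ^+ 2 by rewrite -rmorphXn /= ex rmorph_int.
  by rewrite eqf_sqr => /orP[] /eqP; auto.
(* Since [x] lies in the ring generated by the roots of unity, any morphism with the right effect on
   them computes [chi k]. *)
have chiE k (u : {rmorphism algC -> algC}) : coprime k D ->
    (forall z, z ^+ D = 1 -> u z = z ^+ k) -> chi k = (u x != x).
  move=> ck uz; rewrite /chi; case: {-}_ / idP => [h|]; last by [].
  case: (Qn_aut_exists h) => v vz /=; congr (_ != _).
  by apply: Zmu_eq_aut hx => z hz; rewrite uz // vz.
have chiP k : coprime k D -> exists2 u : {rmorphism algC -> algC},
    (forall z, z ^+ D = 1 -> u z = z ^+ k) & chi k = (u x != x).
  by move=> ck; have [u uz] := Qn_aut_exists ck; exists u => //; exact: chiE.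
exists D, chi; split=> //.
- move=> k l ck cl; have [u uz ->] := chiP k ck; have [v vz ->] := chiP l cl.
  rewrite (@chiE _ (u \o v)) ?coprimeMl ?ck //=; last first.
    by move=> z hz; rewrite vz // rmorphXn uz // exprM.
  by case: (ux u) => eu; case: (ux v) => ev; rewrite ev ?rmorphN ?eu ?opprK ?eqxx ?nx.
- move=> k l ck kl; have [u uz ->] := chiP k ck; rewrite (@chiE l u) //.
    by rewrite -coprime_modl -kl coprime_modl.
  by move=> z hz; rewrite uz // -(expr_mod k hz) kl expr_mod.
(* For [d > 0] the root [x] is real. Complex conjugation fixes it and inverts roots of unity, so [u]
   composed with it raises them to the power [- k], that is [l]. *)
- move=> dp k l ck kl; have [u uz ->] := chiP k ck.
  have xR : x^* = x.
    have : x ^+ 2 == (sqrtC d%:~R) ^+ 2 by rewrite sqrtCK ex.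
    have /CrealP yR : sqrtC (d%:~R : algC) \is Num.real.
      by rewrite ger0_real // sqrtC_ge0 ler0z ltW.
    by rewrite eqf_sqr => /orP[] /eqP ->; rewrite ?rmorphN /= yR.
  rewrite (@chiE l (u \o Num.conj)) /= ?xR //.
    rewrite /coprime -dvdn1 -(eqP ck) dvdn_gcd dvdn_gcdr andbT.
    by rewrite -(dvdn_addl _ (dvdn_gcdl l D)) (dvdn_trans (dvdn_gcdr l D)).
  move=> z hz; have z0 : z != 0.
    by apply: contra_eqN hz => /eqP ->; rewrite expr0n (gtn_eqF D0) eq_sym oner_eq0.
  have nz : `|z| = 1.
    by apply/eqP; rewrite -(pexpr_eq1 D0) // -normrX hz normr1.
  have -> : z^* = z^-1 by rewrite invC_norm nz expr1n invr1 mul1r.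
  rewrite fmorphV uz //; apply: (mulfI (expf_neq0 k z0)).
  rewrite mulfV ?expf_neq0 // -exprD; case/dvdnP: kl => c ->.
  by rewrite mulnC exprM hz expr1n.
- move=> p s f pp op pd pf psf.
  have cp : coprime p D.
    rewrite prime_coprime //; apply/negP => /hD[//|pd'|[p2 _]].
      by rewrite pd' in pd.
    by rewrite p2 in op.
  split=> //; have [u uz ->] := chiP p cp; apply/negbTE; rewrite negbK.
  case: (ux u) => [->//|eu]; exfalso; apply: (negP pd).
  have ps : ~~ (p %| s)%N.
    apply: contra pd => ps; have : (p%:Z %| f%:Z ^+ 2 * d)%Z.
      have : (p%:Z %| s%:Z ^+ 2)%Z by rewrite dvdz_exp.
      move=> h; have -> : f%:Z ^+ 2 * d = s%:Z ^+ 2 - (s%:Z ^+ 2 - f%:Z ^+ 2 * d) by ring.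
      by rewrite rpredB.
    by rewrite dvdzE abszM abszX Euclid_dvdM // Euclid_dvdX // (negbTE pf).
  have fermat t : ~~ (p %| t)%N -> (t%:R ^+ p.-1 == 1 %[mod p])%A.
    move=> pt; have ct : coprime t p by rewrite coprime_sym prime_coprime.
    have := Euler_exp_totient ct; rewrite totient_prime // => /eqP.
    by rewrite -natrX -[1]/(1%:R) -eqAmod_nat.
  have ep : p = (p./2 * 2).+1%N by rewrite -[LHS]odd_double_half op muln2.
  have ep1 : p.-1 = (p./2 * 2)%N by rewrite {1}ep.
  have xA := Zmu_Aint D0 hx.
  have frob := Zmu_frobenius D0 pp op uz hx.
  (* Euler's criterion, multiplied by [f^(p-1)] to avoid inverting [f] modulo [p]. *)
  have e1 : (- x == (f%:R ^+ 2 * d%:~R) ^+ p./2 * x %[mod p])%A.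
    apply: eqAmod_trans (_ : f%:R ^+ p.-1 * - x == _ %[mod p])%A.
      rewrite -{1}[- x]mul1r; apply: eqAmodMr; rewrite ?rpredN //.
      by rewrite eqAmod_sym fermat.
    rewrite ep1 mulnC exprMn -exprM -mulrA; apply: eqAmodMl.
      by rewrite rpredX // rpred_nat.
    rewrite -eu; apply: eqAmod_trans frob _.
    have -> : x ^+ p = d%:~R ^+ p./2 * x by rewrite [in LHS]ep exprS mulnC exprM ex mulrC.
    by rewrite eqAmod_refl.
  have e2 : ((f%:R ^+ 2 * d%:~R) ^+ p./2 * x == x %[mod p])%A.
    rewrite -[X in (_ == X %[mod _])%A]mul1r; apply: eqAmodMr => //.
    apply: eqAmod_trans (_ : s%:R ^+ p.-1 == _ %[mod p])%A; last exact: fermat.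
    rewrite ep1 mulnC exprM; apply: eqAmodX; rewrite ?rpredM ?rpredX ?rpred_nat ?rpred_int //.
    rewrite eqAmod_sym -(eqAmodDr _ (- (f%:R ^+ 2 * d%:~R))) subrr.
    have := eqAmod0_int p (s%:Z ^+ 2 - f%:Z ^+ 2 * d).
    by rewrite psf !expr2 rmorphB !rmorphM.
  have e3 := eqAmod_trans e1 e2.
  (* The congruence [2 x = 0] is multiplied by [x] to become one between integers. *)
  have : ((2 * d)%:~R == 0 %[mod p])%A.
    rewrite rmorphM /= -ex expr2 mulrA eqAmod_sym -[X in (X == _ %[mod _])%A](mul0r x).
    apply: eqAmodMr => //; rewrite mulrDl mul1r -(eqAmodDr _ (- x)) add0r addrK.
    exact: e3.
  rewrite eqAmod0_int dvdzE abszM Euclid_dvdM // dvdn_prime2 //.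
  by case/orP => // /eqP p2; move: op; rewrite (p2 : p = 2%N).
- apply: contrapT => /forall2NP nk.
  have triv k : coprime k D -> chi k = false.
    by move=> ck; apply/negbTE/negP => hk; case: (nk k).
  (* A cyclic group of order [D] yields the [D]-th cyclotomic field. If [chi] were trivial, its
     Galois group would fix [x], which would be rational and an algebraic integer, making [d] a
     square. *)
  have [Qn galQn [QnC extQn [w [prim_w genw] _]]] := group_num_field_exists (Zp_group D).
  rewrite /= card_Zp // in prim_w.
  have [y ey] : exists y, QnC y = x.
    elim: hx {ex x0 x2 nx ux chi chiE chiP triv nk} => [z zD|a _ [b <-]|a a' _ [b <-] _ [b' <-]|a a' _ [b <-] _ [b' <-]].
    + have [i ->] := prim_rootP (etrans (fmorph_primitive_root QnC _ _) prim_w) zD.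
      by exists (w ^+ i); rewrite rmorphXn.
    + by exists (- b); rewrite rmorphN.
    + by exists (b + b'); rewrite rmorphD.
    + by exists (b * b'); rewrite rmorphM.
  have yfix : y \in fixedField 'Gal({:Qn} / 1)%g.
    apply/fixedFieldP; first exact: memvf.
    move=> g gG; have [nu nuE] := extQn g; apply: (fmorph_inj QnC).
    rewrite nuE ey.
    have pzw : D.-primitive_root (QnC w) by rewrite fmorph_primitive_root.
    have nuw : (nu (QnC w)) ^+ D = 1 by rewrite -rmorphXn (prim_expr_order pzw) rmorph1.
    have [i ei] := prim_rootP pzw nuw.
    have ci : coprime i D.
      by rewrite -(prim_root_exp_coprime _ pzw) -ei fmorph_primitive_root.
    apply/eqP; rewrite -[_ == _]negbK -(@chiE i nu ci) ?triv // => z zD.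
    have [j ->] := prim_rootP pzw zD; by rewrite rmorphXn ei exprAC.
  move/galois_fixedField: galQn => galE; rewrite galE in yfix.
  have /vlineP[q eq] := yfix.
  have xq : x = ratr q by rewrite -ey eq alg_num_field fmorph_rat.
  have /intrP[s es] : x \in Num.int.
    by apply: Cint_rat_Aint (Zmu_Aint D0 hx); rewrite xq rpred_rat.
  have /eqP := nsq s; apply; apply: (@intr_inj algC).
  by rewrite -ex es rmorphXn.
Qed.

(** * Values of a quadratic character *)

Lemma odd_sqr_mod8 (n : nat) : odd n -> exists g : int, n%:Z ^+ 2 = 8 * g + 1.
Proof.
move=> on; have [h eh] : exists h : nat, (n./2 * n./2.+1 = 2 * h)%N.
  exists (n./2 * n./2.+1)./2; rewrite mul2n even_halfK //.
  by rewrite oddM /=; case: (odd _).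
exists h%:Z; have -> : n%:Z = 2 * n./2%:Z + 1 by lia.
have -> : 8 * h%:Z = 4 * (n./2%:Z * (n./2%:Z + 1)) :> int.
  have : (n./2 * n./2.+1)%N%:Z = (2 * h)%N%:Z by rewrite eh.
  by rewrite !PoszM -addn1 PoszD => ->; ring.
ring.
Qed.

Section QuadraticCharacterTheory.
Variables (d : int) (D : nat) (chi : nat -> bool).
Hypothesis chiP : quadratic_character d D chi.

Lemma qchar1 : chi 1 = false.
Proof. by have := qcharM chiP (coprime1n D) (coprime1n D); rewrite muln1; case: (chi 1). Qed.

Lemma qcharX k n : coprime k D -> chi (k ^ n) = odd n && chi k.
Proof.
move=> ck; elim: n => [|n IH]; first by rewrite expn0 qchar1.
by rewrite expnS (qcharM chiP) ?coprimeXl // IH /=; case: (chi k); case: (odd n).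
Qed.

(** The full power of one prime is split off at a time; its character is trivial through the prime
    itself or through an even exponent. *)
Lemma qchar_primes n : (0 < n)%N -> coprime n D ->
  (forall p, prime p -> (p %| n)%N -> chi p = false \/ ~~ odd (logn p n)) ->
  chi n = false.
Proof.
have [b] := ubnP n; elim: b n => // b IH n nb n0 cn hn.
have [n1|n1] := leqP n 1; first by rewrite (_ : n = 1%N) ?qchar1 //; lia.
set p := pdiv n; have pp : prime p := pdiv_prime n1.
have pn : (p %| n)%N := pdiv_dvd n.
have [c cpc en] := pfactor_coprime pp n0.
have c0 : (0 < c)%N by move: n0; rewrite en muln_gt0 => /andP[].
have cc : coprime c D by rewrite en coprimeMl in cn; case/andP: cn.
have cp : coprime p D by apply: coprime_dvdl cn.
have lp : (0 < logn p n)%N by rewrite logn_gt0 mem_primes pp n0 pn.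
rewrite en (qcharM chiP) ?coprimeXl // qcharX // (IH c) //.
- by case: (hn p pp pn) => [->|/negbTE ->]; rewrite ?andbF.
- apply: leq_trans (_ : n <= b)%N; last by [].
  by rewrite [X in (_ < X)%N]en ltn_Pmulr // -(expn0 p) ltn_exp2l ?prime_gt1.
- move=> q pq qc; have qp : q != p.
    by apply: contraTneq cpc => qp; rewrite prime_coprime // -qp qc.
  have -> : logn q c = logn q n.
    have pe : (0 < p ^ logn p n)%N by rewrite expn_gt0 prime_gt0.
    rewrite [in RHS]en lognM // lognX.
    by rewrite (logn_prime q pp) (negbTE qp) muln0 addn0.
  by apply: hn => //; rewrite en dvdn_mulr.
Qed.

(* Every odd prime factor of the norm [x^2 - d D^2] splits, and the norm is a
   square modulo [D]; [x] is chosen so that its 2-adic valuation is 3. *)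
Lemma qchar_two : (exists t, d = 8 * t + 1) -> coprime 2 D -> chi 2 = false.
Proof.
move=> [t dt] c2; have D0 := qchar_gt0 chiP.
have oD : odd D by rewrite coprime2n in c2.
pose c := (`|d| * D)%N.
have oc : odd c by rewrite oddM oD; lia.
have [x [e [ex cxd cxD]]] : exists x : nat, exists e : int,
   [/\ x%:Z ^+ 2 - D%:Z ^+ 2 * d = 8 * (2 * e + 1), coprime x `|d| & coprime x D].
  have [a ea] : exists a : int, D%:Z ^+ 2 * d = 8 * a + 1.
    have [g eg] := odd_sqr_mod8 oD.
    by exists (8 * g * t + g + t); rewrite eg dt; ring.
  (* If [a] is odd, [x = 1] works. Otherwise [4 c + 1] is still 1 modulo [d] and [D], and its square
     is [1 + 8 (2 c^2 + c)] with [c] odd, which makes the quotient by 8 odd again. *)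
  have [|] := boolP (2 %| a)%Z => a2; last first.
    by exists 1%N, (- (a + 1) %/ 2)%Z; rewrite !coprime1n ea; split=> //; lia.
  have [g eg] : exists g : int, c%:Z = 2 * g + 1 by exists (c./2)%:Z; lia.
  exists (4 * c + 1)%N, (g ^+ 2 * 4 + 5 * g + 1 - (a %/ 2)%Z); split.
  - have -> : (4 * c + 1)%N%:Z = 8 * g + 5 by lia.
    have [h eh] : exists h, a = 2 * h by exists (a %/ 2)%Z; lia.
    have -> : (a %/ 2)%Z = h by lia.
    rewrite ea eh; ring.
  - have -> : (4 * c + 1 = 4 * D * `|d| + 1)%N by rewrite /c; lia.
    by rewrite /coprime gcdnC gcdnMDl gcdn1.
  - have -> : (4 * c + 1 = 4 * `|d| * D + 1)%N by rewrite /c; lia.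
    by rewrite /coprime gcdnC gcdnMDl gcdn1.
pose N := absz (x%:Z ^+ 2 - D%:Z ^+ 2 * d)%R; pose n := absz (2 * e + 1)%R.
have eN : N = (2 ^ 3 * n)%N by rewrite /N ex abszM.
have n0 : (0 < n)%N by rewrite /n; lia.
have on : odd n by rewrite /n; lia.
have cN : coprime N D.
  have : coprimez D%:Z (x%:Z ^+ 2 - D%:Z ^+ 2 * d).
    have -> : x%:Z ^+ 2 - D%:Z ^+ 2 * d = (- (D%:Z * d)) * D%:Z + x%:Z ^+ 2 by ring.
    by rewrite /coprimez gcdzMDl -/(coprimez _ _) coprimezXr // coprimezE coprime_sym.
  by rewrite coprimezE coprime_sym.
have cn : coprime n D by move: cN; rewrite eN coprimeMl => /andP[].
have chiN : chi N = false.
  have -> : chi N = chi (x ^ 2)%N; last by rewrite qcharX.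
  have eX : x%:Z ^+ 2 = (x ^ 2)%N%:Z by rewrite -mulnn PoszM.
  (* Modulo [D], [N] is [x^2] up to sign; a minus sign occurs only for [d > 0], where it does not
     change [chi]. *)
  have [d0|d0] := ltP 0 d; last first.
    have eN' : N = (D * `|d| * D + x ^ 2)%N.
      have eD : D%:Z ^+ 2 * d = - (D * `|d| * D)%N%:Z by rewrite !PoszM lez0_abs //; ring.
      by rewrite /N eX eD; lia.
    by apply: (qchar_mod chiP cN); rewrite eN' modnMDl.
  have eD : D%:Z ^+ 2 * d = (D * `|d| * D)%N%:Z by rewrite !PoszM gtz0_abs //; ring.
  have [h|h] := leqP (D * `|d| * D) (x ^ 2).
    apply: (qchar_mod chiP cN).
    have -> : (x ^ 2 = D * `|d| * D + N)%N by rewrite /N eX eD; lia.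
    by rewrite modnMDl.
  apply: (qchar_opp chiP d0 cN).
  have -> : (N + x ^ 2 = D * `|d| * D)%N by rewrite /N eX eD; lia.
  exact: dvdn_mull.
have chin : chi n = false.
  apply: qchar_primes => // p pp pn; left.
  have pN : (p%:Z %| x%:Z ^+ 2 - D%:Z ^+ 2 * d)%Z.
    by rewrite dvdzE absz_nat -/N eN dvdn_mull.
  have pD : ~~ (p %| D)%N by rewrite -prime_coprime // (coprime_dvdl pn).
  have op : odd p by apply: dvdn_odd pn on.
  have pd : ~~ (p %| `|d|)%N.
    apply/negP => pd; have : (p%:Z %| x%:Z ^+ 2)%Z.
      rewrite -[x%:Z ^+ 2](subrK (D%:Z ^+ 2 * d)) rpredD // dvdz_mull //.
    rewrite dvdzE abszX Euclid_dvdX // => /andP[px _].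
    move: cxd; rewrite /coprime => /eqP g1.
    have : (p %| 1)%N by rewrite -g1 dvdn_gcd px.
    by rewrite dvdn1 => /eqP p1; rewrite p1 in pp.
  by have [] := qchar_split chiP pp op pd pD pN.
by move: chiN; rewrite eN (qcharM chiP) ?coprimeXl // chin qcharX // addbF.
Qed.

(** The exponent 3 serves twice: [p^2] already forces [p] not to divide the squarefree [d], and for
    [p = 2] the modulus 8 makes [d] equal to 1 modulo 8. *)
Lemma qchar_square (p s : nat) : squarefree d -> prime p ->
  ((p ^ 3)%N%:Z %| s%:Z ^+ 2 - d)%Z -> coprime p D /\ chi p = false.
Proof.
move=> sf pp psd; have pd : ~~ (p %| `|d|)%N.
  apply: contra (sf p pp) => pd.
  have h1 : (p%:Z %| s%:Z ^+ 2 - d)%Z.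
    by apply: dvdz_trans psd; rewrite dvdzE !absz_nat dvdn_exp.
  have : (p%:Z %| s%:Z ^+ 2)%Z by rewrite -[s%:Z ^+ 2](subrK d) rpredD.
  rewrite dvdzE abszX Euclid_dvdX // => /andP[ps _].
  have h2 : ((p ^ 2)%N%:Z %| s%:Z ^+ 2)%Z by rewrite dvdzE abszX !absz_nat dvdn_exp2r.
  have h3 : ((p ^ 2)%N%:Z %| s%:Z ^+ 2 - d)%Z.
    by apply: dvdz_trans psd; rewrite dvdzE !absz_nat dvdn_exp2l.
  have : ((p ^ 2)%N%:Z %| d)%Z.
    by rewrite -(subKr (s%:Z ^+ 2) d) rpredB.
  by rewrite dvdzE.
have [op|] := boolP (odd p).
  apply: (@qchar_split _ _ _ chiP p s 1) => //; first by rewrite dvdn1; case: eqP pp => // ->.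
  by rewrite expr1n mul1r; apply: dvdz_trans psd; rewrite dvdzE !absz_nat dvdn_exp.
move=> ep; have p2 : p = 2%N by case: (even_prime pp) => // op; rewrite op in ep.
rewrite p2 in psd pd *.
have d8 : exists t, d = 8 * t + 1.
  case/dvdzP: psd => q eq.
  have os : odd s.
    apply: contraNT pd => es; rewrite -[(_ %| _)%N]/(2%:Z %| d)%Z.
    apply/dvdzP; exists (2 * s./2%:Z ^+ 2 - 4 * q).
    have es' : s%:Z = 2 * s./2%:Z by lia.
    rewrite es' in eq; rewrite -(subKr ((2 * s./2%:Z) ^+ 2) d) eq.
    by rewrite (_ : (2 ^ 3)%N%:Z = 8) //; ring.
  have [g eg] := odd_sqr_mod8 os.
  by exists (g - q); rewrite eg in eq; lia.
have c2 : coprime 2 D.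
  rewrite prime_coprime //; apply/negP => D2; have [|[_ h]] := qchar_dvd chiP (isT : prime 2) D2.
    exact/negP.
  by case: d8 => t dt; have /eqP := h (2 * t); apply; rewrite dt; ring.
by split=> //; exact: qchar_two.
Qed.

End QuadraticCharacterTheory.

(* The product formula for the rational number [A / B], which is close to [h^2 / k]
   at the primes dividing [D]. *)
Lemma qchar_reciprocity (d : int) (D : nat) (chi : nat -> bool) (k h B : nat) (A : int) :
  quadratic_character d D chi -> coprime k D -> (0 < k)%N -> (0 < h)%N -> (0 < B)%N -> A != 0 ->
  0 < d \/ 0 < A ->
  (forall p, prime p -> (p %| D)%N -> ~~ (p %| B)%N /\
     ((p ^ logn p (D * h ^ 2))%N%:Z %| k%:Z * A - (h ^ 2)%N%:Z * B%:Z)%Z) ->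
  (forall p, prime p -> ~~ (p %| D)%N ->
     chi p = false \/ ~~ odd (logn p `|A|) && ~~ odd (logn p B)) ->
  chi k = false.
Proof.
move=> chiP ck k0 h0 B0 A0 sgn ram unram; have D0 := qchar_gt0 chiP.
(* The part [h1] of [h] carries the primes dividing [D]. The congruence makes [h1^2] divide [A];
   dividing by it leaves [k A' = h2^2 B] modulo [D], with all factors prime to [D]. *)
pose h1 := (h`_(\pi(D)))%N; pose h2 := (h`_(\pi(D)^'))%N.
have eh : h = (h1 * h2)%N by rewrite partnC.
have h10 : (0 < h1)%N := part_gt0 _ _.
have h20 : (0 < h2)%N := part_gt0 _ _.
have ch2 : coprime h2 D.
  rewrite coprime_sym; apply: (@pnat_coprime \pi(D)); first exact: pnat_pi.
  exact: part_pnat.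
have cop n : (0 < n)%N -> (forall p, prime p -> (p %| D)%N -> ~~ (p %| n)%N) -> coprime n D.
  move=> n0 hn; rewrite coprime_has_primes //; apply/hasPn => p.
  rewrite !mem_primes n0 D0 /= => /andP[pp pD]; rewrite pp /=; exact: hn.
have cB : coprime B D by apply: cop => // p pp pD; case: (ram p pp pD).
have dvd : ((D * h1 ^ 2)%N%:Z %| k%:Z * A - (h ^ 2)%N%:Z * B%:Z)%Z.
  rewrite dvdzE absz_nat; apply/dvdn_partP; first by rewrite muln_gt0 D0 expn_gt0 h10.
  move=> p; rewrite mem_primes => /and3P[pp _ pn]; rewrite p_part.
  have pD : (p %| D)%N.
    move: pn; rewrite Euclid_dvdM // => /orP[//|]; rewrite Euclid_dvdX // => /andP[ph _].
    have /pnatP := part_pnat \pi(D) h => /(_ h10 p pp ph).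
    by rewrite mem_primes => /and3P[].
  have [_] := ram p pp pD; rewrite dvdzE absz_nat; apply: dvdn_trans.
  apply: dvdn_exp2l; apply: dvdn_leq_log; first by rewrite muln_gt0 D0 expn_gt0 h0.
  by rewrite dvdn_mul // dvdn_exp2r // eh dvdn_mulr.
have ch1k : coprime k (h1 ^ 2).
  rewrite coprimeXr //; rewrite coprime_sym; apply: (@pnat_coprime \pi(D)); first exact: part_pnat.
  by rewrite -coprime_pi' // coprime_sym.
have [A' eA] : exists A', A = A' * (h1 ^ 2)%N%:Z.
  apply/dvdzP; rewrite -(@Gauss_dvdzr _ k%:Z); last by rewrite coprimezE coprime_sym.
  rewrite -[k%:Z * A](subrK ((h ^ 2)%N%:Z * B%:Z)) rpredD //.
    by apply: dvdz_trans dvd; rewrite dvdzE !absz_nat dvdn_mull.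
  by rewrite dvdz_mulr // dvdzE !absz_nat dvdn_exp2r // eh dvdn_mulr.
have dvd' : (D%:Z %| k%:Z * A' - (h2 ^ 2)%N%:Z * B%:Z)%Z.
  have hh : ((h1 ^ 2)%N%:Z : int) != 0 by rewrite eqz_nat expn_eq0 negb_and -lt0n h10.
  rewrite -(dvdz_mul2r hh) -PoszM; congr (_ %| _)%Z: dvd.
  by rewrite eA eh expnMn !PoszM; ring.
have A'0 : A' != 0 by apply: contraNneq A0 => e; rewrite eA e mul0r.
have aA' : (0 < `|A'|)%N by rewrite absz_gt0.
have cA' : coprime `|A'| D.
  apply: cop => // p pp pD; apply/negP => pA.
  have pd : (p%:Z %| k%:Z * A' - (h2 ^ 2)%N%:Z * B%:Z)%Z by apply: dvdz_trans dvd'.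
  have : (p%:Z %| (h2 ^ 2)%N%:Z * B%:Z)%Z.
    have -> : (h2 ^ 2)%N%:Z * B%:Z = k%:Z * A' - (k%:Z * A' - (h2 ^ 2)%N%:Z * B%:Z) by ring.
    by rewrite rpredB // dvdz_mull.
  rewrite dvdzE abszM !absz_nat Euclid_dvdM // Euclid_dvdX // andbT => /orP[] hp.
    have : coprime p D by apply: coprime_dvdl ch2.
    by rewrite prime_coprime // pD.
  have : coprime p D by apply: coprime_dvdl cB.
  by rewrite prime_coprime // pD.
have chiA : chi `|A'|%N = false.
  apply: (qchar_primes chiP) => // p pp pA.
  have pD : ~~ (p %| D)%N by rewrite -prime_coprime // (coprime_dvdl pA).
  case: (unram p pp pD) => [->|/andP[oA _]]; [by left|right; move: oA].
  by rewrite eA abszM absz_nat lognM ?expn_gt0 ?h10 // lognX oddD oddM addbF.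
have chiB : chi B = false.
  apply: (qchar_primes chiP) => // p pp pB.
  have pD : ~~ (p %| D)%N by rewrite -prime_coprime // (coprime_dvdl pB).
  by case: (unram p pp pD) => [->|/andP[_ ->]]; [left|right].
have chikA : chi (k * `|A'|)%N = chi k.
  by rewrite (qcharM chiP) // chiA addbF.
have chihB : chi (h2 ^ 2 * B)%N = false.
  by rewrite (qcharM chiP) ?coprimeXl // chiB addbF (qcharX chiP).
have ckA : coprime (k * `|A'|) D by rewrite coprimeMl ck.
rewrite -chikA -chihB.
(* For [A' < 0] the absolute value introduces a sign, harmless because [d > 0] in that case. *)
have [Ap|An] := ltP 0 A'.
  apply: (qchar_mod chiP ckA); apply/eqP; rewrite -[_ == _]/(_ == _ :> nat) -eqz_nat.
  rewrite -!modz_nat -[(_ == _)]/(_ == _ %[mod _])%Z eqz_mod_dvd !PoszM gtz0_abs //.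
have dp : 0 < d.
  by case: sgn => //; rewrite eA pmulr_lgt0 ?ltz_nat ?expn_gt0 ?h10 // ltNge An.
apply: (qchar_opp chiP dp ckA).
rewrite -[(_ %| _)%N]/(D%:Z %| (_ + _)%N%:Z)%Z PoszD !PoszM lez0_abs //.
have -> : k%:Z * - A' + (h2 ^ 2)%N%:Z * B%:Z = - (k%:Z * A' - (h2 ^ 2)%N%:Z * B%:Z) by ring.
by rewrite rpredN.
Qed.

(** * The p-adic numbers *)

Lemma fraction_numden (R : idomainType) (x : {fraction R}) :
  exists a b : R, b != 0 /\ x * FracField.tofrac b = FracField.tofrac a.
Proof.
elim/quotW: x => r; exists (frac r).1, (frac r).2; split; first exact: denom_ratioP.
unlock FracField.tofrac; rewrite -[LHS]FracField.pi_mul /FracField.mulf.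
apply/eqmodP; rewrite /= FracField.equivfE !(numden_Ratio, mulr1, oner_neq0) ?denom_ratioP //.
by rewrite mulrC.
Qed.

Section PadicTheory.
Variable p : prime_nat.
Local Notation Zp := (padic_int p).
Local Notation Qp := (padic p).
Local Notation iota := (padic_of_int p).
Implicit Types (x y z : Zp) (n : nat).

Lemma padic_of_int_inj : injective iota.
Proof. by move=> x y /eqP; rewrite tofrac_eq => /eqP. Qed.

Lemma primeX_residue n : ((p%:R : Zp) ^+ n) n = 0%N.
Proof. by rewrite -natrX natr_padic modnn. Qed.

Lemma residue_dvd x n : x n = 0%N -> exists y, x = p%:R ^+ n * y.
Proof.
move=> xn; have dx k : (p ^ n %| x (n + k))%N by rewrite /dvdn residue_le xn.
(* The [k]-th residue of the quotient is read at level [n + k], as dividing by [p^n] costs [n]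
   digits. *)
have yP k : (x (n + k) %/ p ^ n = x (n + k.+1) %/ p ^ n %[mod p ^ k])%N.
  rewrite !modn_divl -expnD; congr (_ %/ _)%N.
  by rewrite (addnC k n) addnS -residueP residue_mod.
exists (mk_padic yP); apply: padic_int_ext => k /=.
rewrite -natrX natr_padic modnMml modnMmr mulnC divnK //.
by rewrite addnC residue_le.
Qed.

Lemma dvd_residue x y n : x = p%:R ^+ n * y -> x n = 0%N.
Proof. by move=> -> /=; rewrite primeX_residue mul0n mod0n. Qed.

Lemma residue_approx x n : exists y, x = (x n)%:R + p%:R ^+ n * y.
Proof.
have [|y ey] := @residue_dvd (x - (x n)%:R) n.
  rewrite /= natr_padic residue_mod modnDmr subnKC ?modnn //.
  by rewrite -(residue_mod x) ltnW // ltn_mod prime_nat_expn_gt0.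
by exists y; rewrite -ey addrC subrK.
Qed.

Lemma residue1_dvd x n : (0 < n)%N -> (x n %% p)%N = x 1%N.
Proof. by case: n => // n _; rewrite -[in RHS](residue_le x 1 n) expn1. Qed.

Lemma padic_unitP x : reflect (x 1%N <> 0%N) (x \is a GRing.unit).
Proof.
have pp := prime_natP p.
apply: (iffP idP) => [|x1].
  move=> xu x0; have [y xy] := residue_dvd x0.
  have /(congr1 (fun z : Zp => z 1%N)) := mulVr xu.
  by rewrite /= x0 muln0 mod0n modn_small // expn1 prime_gt1.
have cx n : coprime (x n) (p ^ n).
  case: n => [|n]; first by rewrite coprimen1.
  rewrite coprimeXr // coprime_sym prime_coprime //.
  by apply/negP; rewrite /dvdn residue1_dvd // => /eqP.
(* By Euler's theorem this power inverts [x n] modulo [p^n]. *)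
pose y n := (x n ^ (totient (p ^ n)).-1)%N.
have xy n : (x n * y n = 1 %[mod p ^ n])%N.
  rewrite -expnS prednK ?totient_gt0 ?prime_nat_expn_gt0 //.
  exact: Euler_exp_totient.
have yP n : (y n = y n.+1 %[mod p ^ n])%N.
  have h : (x n * y n.+1 = 1 %[mod p ^ n])%N.
    rewrite (residueP x n) modnMml; have := xy n.+1.
    move=> /(congr1 (fun k => k %% p ^ n)%N).
    by rewrite !modn_dvdm // dvdn_exp2l.
  rewrite -[y n]muln1 -modnMmr -h modnMmr mulnA -modnMml [(y n * _)%N]mulnC xy.
  by rewrite modnMml mul1n.
apply/asboolP; exists (mk_padic yP); apply: padic_int_ext => n /=.
by rewrite modnMml mulnC xy.
Qed.

Lemma unit_1Dp x : 1 + p%:R * x \is a GRing.unit.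
Proof.
apply/padic_unitP => /residue_dvd[y ey].
have /dvd_residue /= : 1 = p%:R ^+ 1 * (y - x) by rewrite mulrBr -ey expr1 addrK.
by rewrite expn1 modn_small // prime_gt1 // prime_natP.
Qed.

Lemma nat_unit k : ~~ (p %| k)%N -> (k%:R : Zp) \is a GRing.unit.
Proof. by move=> pk; apply/padic_unitP; rewrite natr_padic expn1; apply/eqP. Qed.

Lemma int_unit (k : int) : ~~ (p %| `|k|)%N -> (k%:~R : Zp) \is a GRing.unit.
Proof.
case: k => k; first exact: nat_unit.
by rewrite NegzE abszN rmorphN unitrN; exact: nat_unit.
Qed.

Lemma padic_int_dvd (k : int) n y :
  k%:~R = p%:R ^+ n * y -> ((p ^ n)%N%:Z %| k)%Z.
Proof.
have H (j : nat) z : j%:R = p%:R ^+ n * z -> (p ^ n %| j)%N.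
  by move=> /dvd_residue; rewrite natr_padic => /eqP.
case: k => k; first by move/H.
rewrite NegzE rmorphN => /(congr1 -%R); rewrite opprK -mulrN => /H.
by rewrite dvdzE abszN.
Qed.

Lemma padic_int_factor x : x != 0 ->
  exists n u, u \is a GRing.unit /\ x = p%:R ^+ n * u.
Proof.
move=> /padic_int_neq0 ex; have ex' : exists n, x n != 0%N.
  by case: ex => n xn; exists n; apply: contraNneq xn => ->; rewrite dvdn0.
(* The valuation is one less than the first index with a non-zero residue. *)
case: (ex_minnP ex') => [[|n]] xn hn.
  by move: xn; rewrite -(residue_mod x) expn0 modn1.
have x0 : x n = 0%N by apply: contraTeq (ltnSn n) => /hn; rewrite -leqNgt.
have [y ey] := residue_dvd x0; exists n, y; split=> //.
apply/padic_unitP => /residue_dvd[z ez].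
have /dvd_residue : x = p%:R ^+ n.+1 * z by rewrite ey ez expr1 mulrA -exprSr.
by apply/eqP.
Qed.

Lemma natr_padic_neq0 : (p%:R : Qp) != 0.
Proof.
rewrite -(rmorph_nat iota) tofrac_eq0 natr_padic_eq0.
by rewrite -lt0n prime_gt0 // prime_natP.
Qed.

(** Exponents on both sides stand for the possibly negative valuation [m - n]. *)
Lemma padic_factor (x : Qp) : x != 0 ->
  exists m n u, u \is a GRing.unit /\ x * p%:R ^+ n = p%:R ^+ m * iota u.
Proof.
move=> x0; have [a [b [b0 xb]]] := fraction_numden x.
have a0 : a != 0.
  by rewrite -tofrac_eq0 -xb mulf_neq0 // tofrac_eq0.
have [m [u [uu ea]]] := padic_int_factor a0.
have [n [v [vu eb]]] := padic_int_factor b0.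
exists m, n, (u / v); split; first by rewrite unitrM uu unitrV.
have e : x * (p%:R ^+ n * iota v) = p%:R ^+ m * iota u.
  have := xb; rewrite eb ea -[FracField.tofrac _]/(iota _).
  rewrite -[X in _ = X]/(iota _) !rmorphM !rmorphXn !rmorph_nat //.
rewrite rmorphM mulrA -e -!mulrA -rmorphM mulrV // rmorph1 mulr1 //.
Qed.

End PadicTheory.

(** * Points of the projective space and of the Markoff surface *)

Definition point_of (A : comUnitRingType) (a : 'rV[A]_4) (ha : primitive A a) : proj3 A :=
  proj3_of (SigSub (mem_set ha)).

Section ProjectiveSpace.
Variable A : comUnitRingType.
Implicit Types (a b : 'rV[A]_4) (x : proj3 A) (c : A).

(** [hcoord] reads an arbitrarily chosen representative, so coordinates are known only up to a
    unit. *)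
Lemma hcoord_proj3_of (a : primitive A) :
  exists2 c, c \is a GRing.unit & hcoord (proj3_of a) = c *: val a.
Proof.
have /eqmodP /asboolP[c cU e] : (repr (proj3_of a) = a %[mod proj3 A])%qT by rewrite reprK.
by exists c.
Qed.

Lemma hcoord_point_of a (ha : primitive A a) :
  exists2 c, c \is a GRing.unit & hcoord (point_of ha) = c *: a.
Proof. exact: hcoord_proj3_of. Qed.

Lemma point_of_eq a b (ha : primitive A a) (hb : primitive A b) c :
  c \is a GRing.unit -> a = c *: b -> point_of ha = point_of hb.
Proof. by move=> cU e; apply/eqmodP/asboolP; exists c. Qed.

Lemma hcoord_primitive x : primitive A (hcoord x).
Proof. exact: set_valP. Qed.

Lemma point_of_hcoord x : point_of (hcoord_primitive x) = x.
Proof.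
rewrite -[RHS]reprK; apply/eqmodP/asboolP; exists 1; first exact: unitr1.
by rewrite scale1r.
Qed.

Definition on_markoff (m : int) a : Prop :=
  a 0 ord0 * (\sum_i a 0 (coord_index i) ^+ 2) - \prod_i a 0 (coord_index i)
  = m%:~R * a 0 ord0 ^+ 3.

Lemma on_markoffZ m c a : c \is a GRing.unit -> on_markoff m (c *: a) <-> on_markoff m a.
Proof.
move=> cU; rewrite /on_markoff !mxE.
have -> : \sum_i (c *: a) 0 (coord_index i) ^+ 2 =
          c ^+ 2 * \sum_i a 0 (coord_index i) ^+ 2.
  by rewrite mulr_sumr; apply: eq_bigr => i _; rewrite mxE exprMn.
have -> : \prod_i (c *: a) 0 (coord_index i) = c ^+ 3 * \prod_i a 0 (coord_index i).
  have -> : c ^+ 3 = \prod_(i < 3) c by rewrite prodr_const card_ord.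
  rewrite -big_split /=.
  by apply: eq_bigr => i _; rewrite mxE.
set S := \sum_i _; set P := \prod_i _.
have -> : c * a 0 ord0 * (c ^+ 2 * S) - c ^+ 3 * P = c ^+ 3 * (a 0 ord0 * S - P) by ring.
have -> : m%:~R * (c * a 0 ord0) ^+ 3 = c ^+ 3 * (m%:~R * a 0 ord0 ^+ 3) by ring.
by split=> [|->//]; apply: mulrI; rewrite unitrX.
Qed.

Lemma markoff_point_of m a (ha : primitive A a) :
  markoff_points m A (point_of ha) <-> on_markoff m a.
Proof.
have [c cU e] := hcoord_point_of ha.
by rewrite -(on_markoffZ m a cU) -e.
Qed.

End ProjectiveSpace.

Section ProjectiveMap.
Variables (A B : comUnitRingType) (f : {rmorphism A -> B}).

Lemma hcoord_map (x : proj3 A) : exists2 c, c \is a GRing.unit &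
  hcoord (proj3_map f x) = c *: map_mx f (hcoord x).
Proof. exact: hcoord_proj3_of. Qed.

Lemma proj3_map_point_of (a : 'rV[A]_4) (ha : primitive A a)
    (hb : primitive B (map_mx f a)) :
  proj3_map f (point_of ha) = point_of hb.
Proof.
have [c cU e] := hcoord_point_of ha.
apply/eqmodP/asboolP; exists (f c); first exact: rmorph_unit.
by rewrite /= -map_mxZ -e.
Qed.

Lemma on_markoff_map_iff m (a : 'rV[A]_4) : on_markoff m (map_mx f a) <->
  f (a 0 ord0 * (\sum_i a 0 (coord_index i) ^+ 2) - \prod_i a 0 (coord_index i))
  = f (m%:~R * a 0 ord0 ^+ 3).
Proof.
have -> : f (m%:~R * a 0 ord0 ^+ 3) = m%:~R * f (a 0 ord0) ^+ 3.
  by rewrite rmorphM rmorph_int rmorphXn.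
rewrite /on_markoff !mxE rmorphB rmorphM rmorph_sum rmorph_prod.
have -> : \sum_i map_mx f a 0 (coord_index i) ^+ 2 = \sum_i f (a 0 (coord_index i) ^+ 2).
  by apply: eq_bigr => i _; rewrite mxE rmorphXn.
have -> // : \prod_i map_mx f a 0 (coord_index i) = \prod_i f (a 0 (coord_index i)).
by apply: eq_bigr => i _; rewrite mxE.
Qed.

Lemma on_markoff_map m (a : 'rV[A]_4) : on_markoff m a -> on_markoff m (map_mx f a).
Proof. by move=> e; apply/on_markoff_map_iff; congr (f _). Qed.

Lemma on_markoff_map_inj m (a : 'rV[A]_4) : injective f ->
  on_markoff m (map_mx f a) -> on_markoff m a.
Proof. by move=> fI /on_markoff_map_iff/fI. Qed.

End ProjectiveMap.

Lemma map_mx_intr (A B : comUnitRingType) (f : {rmorphism A -> B}) m n (a : 'M[int]_(m, n)) :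
  map_mx f (map_mx intr a : 'M[A]_(m, n)) = map_mx intr a.
Proof. by apply/matrixP => i j; rewrite !mxE rmorph_int. Qed.

(** The finite weight may sit at any index [i]; the other two are named relative to it. *)
Lemma ord3_others (i : 'I_3) : exists j l : 'I_3,
  [/\ j != i, l != i, l != j & forall s, [\/ s = i, s = j | s = l]].
Proof.
pose o0 : 'I_3 := ord0; pose o1 : 'I_3 := lift ord0 ord0; pose o2 : 'I_3 := ord_max.
have all s : [\/ s = o0, s = o1 | s = o2].
  by case: s => [[|[|[|//]]] ?]; [apply: Or31|apply: Or32|apply: Or33]; exact: val_inj.
case: (all i) => ->; [exists o1, o2 | exists o0, o2 | exists o0, o1]; split=> // s;
  by case: (all s) => ->; by [apply: Or31 | apply: Or32 | apply: Or33].
Qed.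

Lemma ord3_third (i j : 'I_3) : j != i ->
  exists l : 'I_3, [/\ l != i, l != j & forall s, [\/ s = i, s = j | s = l]].
Proof.
move=> ji; have [j' [l' [ji' li' lj' all]]] := ord3_others i.
case: (all j) ji => -> ji; first by rewrite eqxx in ji.
  by exists l'.
exists j'; split=> //; first by rewrite eq_sym.
by move=> s; case: (all s); by [apply: Or31 | apply: Or32 | apply: Or33].
Qed.

Lemma big_ord3 (T : Type) (idx : T) (op : Monoid.com_law idx) (F : 'I_3 -> T) (i j l : 'I_3) :
  j != i -> l != i -> l != j -> (forall s, [\/ s = i, s = j | s = l]) ->
  \big[op/idx]_s F s = op (F i) (op (F j) (F l)).
Proof.
move=> ji li lj all; rewrite (bigD1 i) // (bigD1 j) // (bigD1 l) /=; last by rewrite li lj.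
rewrite big_pred0 ?Monoid.mulm1 // => s.
by case: (all s) => ->; rewrite eqxx ?andbF.
Qed.

(* The points of the conic [u_i = k + 1/k], on which the Markoff equation reads
   [(u_j - k u_l) (u_j - u_l / k) = m - u_i^2]; the first factor is [r E / k]. *)
Definition markoff_vec (m k r : int) (i j : 'I_3) : 'rV[int]_4 :=
  let E := m * k ^+ 2 - (k ^+ 2 + 1) ^+ 2 in
  \row_t (if unlift ord0 t is Some s then
            if s == i then r * (k ^+ 2 - 1) * (k ^+ 2 + 1)
            else if s == j then k ^+ 2 - r ^+ 2 * E
            else k * (1 - r ^+ 2 * E)
          else k * (r * (k ^+ 2 - 1))).

Lemma markoff_vec0 m k r i j : markoff_vec m k r i j 0 ord0 = k * (r * (k ^+ 2 - 1)).
Proof. by rewrite mxE unlift_none. Qed.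

Lemma markoff_vecE m k r i j s : markoff_vec m k r i j 0 (coord_index s) =
  if s == i then r * (k ^+ 2 - 1) * (k ^+ 2 + 1)
  else if s == j then k ^+ 2 - r ^+ 2 * (m * k ^+ 2 - (k ^+ 2 + 1) ^+ 2)
  else k * (1 - r ^+ 2 * (m * k ^+ 2 - (k ^+ 2 + 1) ^+ 2)).
Proof. by rewrite mxE /coord_index liftK. Qed.

Lemma markoff_vecP m k r i j : j != i -> on_markoff m (markoff_vec m k r i j).
Proof.
move=> ji; have [l [li lj all]] := ord3_third ji.
rewrite /on_markoff (big_ord3 _ _ ji li lj all) (big_ord3 _ _ ji li lj all) /=.
rewrite !markoff_vecE markoff_vec0 eqxx (negbTE ji) (negbTE li) (negbTE lj) eqxx intz.
ring.
Qed.

Lemma PoszX (x n : nat) : (x ^ n)%N%:Z = x%:Z ^+ n.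
Proof. by elim: n => // n IH; rewrite expnS PoszM IH exprS. Qed.

(** * Intersection multiplicities with the boundary *)

Section LocalMultiplicity.
Variable p : prime_nat.
Local Notation Zp := (padic_int p).

Lemma boundary_multiplicity_point_of (a : 'rV[Zp]_4) (ha : primitive Zp a) s n :
  (exists y, a 0 ord0 = y * p%:R ^+ n) ->
  (exists y, a 0 (coord_index s) = y * p%:R ^+ n) ->
  (exists y z, p%:R ^+ n = y * a 0 ord0 + z * a 0 (coord_index s)) ->
  boundary_multiplicity s (point_of ha) (Some n).
Proof.
move=> [y0 e0] [ys es] [y [z e]]; have [c cU ec] := hcoord_point_of ha.
rewrite /boundary_multiplicity /boundary_ideal ec; apply/seteqP; split => t /=.
  move=> [u [v ->]]; exists (c * (u * y0 + v * ys)); rewrite !mxE e0 es; ring.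
move=> [u ->]; exists (u * y / c), (u * z / c); rewrite !mxE e.
by rewrite -!mulrA !(mulKr cU) ; ring.
Qed.

Lemma boundary_multiplicity0 (a : 'rV[Zp]_4) (ha : primitive Zp a) s :
  a 0 ord0 \is a GRing.unit \/ a 0 (coord_index s) \is a GRing.unit ->
  boundary_multiplicity s (point_of ha) (Some 0%N).
Proof.
move=> h; apply: boundary_multiplicity_point_of.
- by exists (a 0 ord0); rewrite expr0 mulr1.
- by exists (a 0 (coord_index s)); rewrite expr0 mulr1.
- case: h => h; first by exists (a 0 ord0)^-1, 0; rewrite mul0r addr0 mulVr.
  by exists 0, (a 0 (coord_index s))^-1; rewrite mul0r add0r mulVr.
Qed.

(** As [p] divides [r] but not [k], the coordinates other than [x_0] and [x_i] are units, so only
    [D_i] is met. The choice of [r] makes [r (k^2 - 1)] equal to [(p (k^2 - 1))^w], whose valuation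
    is a positive multiple of [w], as suits both notions. *)
Lemma semi_integral_markoff_vec m omega kind (i j : 'I_3) w (k : nat) (r : int)
    (hQ : primitive (padic p) (map_mx intr (markoff_vec m k%:Z r i j))) :
  omega i = Some w -> (0 < w)%N -> j != i -> ~~ (p %| k)%N -> (1 < k)%N ->
  r = p%:Z ^+ w * (k%:Z ^+ 2 - 1) ^+ w.-1 ->
  semi_integral_Zp m omega kind p (point_of hQ).
Proof.
move=> ow w0 ji pk k1 er; have [l [li lj all]] := ord3_third ji.
have pp := prime_natP p.
set a := markoff_vec _ _ _ _ _ in hQ *.
have kU : (k%:R : Zp) \is a GRing.unit by exact: nat_unit.
have unit_s s : s != i -> (a 0 (coord_index s))%:~R \is a @GRing.unit Zp.
  move=> si; apply: int_unit.
  have pr : (p%:Z %| r)%Z by rewrite er -(prednK w0) exprS -!mulrA dvdz_mulr.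
  change (~~ (p%:Z %| (a 0 (coord_index s))%R)%Z).
  rewrite markoff_vecE (negbTE si); set E := m * _ - _.
  have nk e : (p%:Z %| k%:Z ^+ e)%Z -> False.
    rewrite dvdzE abszX !absz_nat Euclid_dvdX // => /andP[pk' _].
    by rewrite pk' in pk.
  case: ifP => _; apply/negP => h; apply: (nk 2%N).
  - rewrite -[k%:Z ^+ 2](subrK (r ^+ 2 * E)); rewrite rpredD // dvdz_mulr //.
    by rewrite expr2 dvdz_mulr.
  - have -> : k%:Z ^+ 2 = k%:Z * (k%:Z * (1 - r ^+ 2 * E)) + k%:Z ^+ 2 * r * E * r by ring.
    by rewrite rpredD // dvdz_mull.
have hZ : primitive Zp (map_mx intr a).
  by exists (coord_index j); rewrite mxE unit_s.
have [g cpg eg] := @pfactor_coprime p (k ^ 2 - 1)%N pp ltac:(nia).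
set e := logn _ _ in eg.
have gU : (g%:R : Zp) \is a GRing.unit by apply: nat_unit; rewrite -prime_coprime.
have ek : (k ^ 2 - 1)%N%:Z = k%:Z ^+ 2 - 1 by rewrite -subzn ?expn_gt0 ?(ltnW k1) // -mulnn PoszM.
have eq : ((r * (k%:Z ^+ 2 - 1))%:~R : Zp) = g%:R ^+ w * p%:R ^+ (w * e.+1).
  have -> : r * (k%:Z ^+ 2 - 1) = ((g ^ w) * p ^ (w * e.+1))%N%:Z.
    rewrite er -mulrA -exprSr prednK // -ek eg mulnS expnD expnM mulnC.
    rewrite !PoszM !PoszX exprMn -exprM mulnC exprM.
    by move: (_ ^+ w) (_ ^+ e ^+ w) (g%:Z ^+ w) => x y z; ring.
  by rewrite -pmulrn natrM !natrX.
have [q q_def eq'] : exists2 q, q = r * (k%:Z ^+ 2 - 1) &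
  (q%:~R : Zp) = g%:R ^+ w * p%:R ^+ (w * e.+1) by exists (r * (k%:Z ^+ 2 - 1)).
have mult s : s != i -> boundary_multiplicity s (point_of hZ) (Some 0%N).
  by move=> si; apply: boundary_multiplicity0; right; rewrite mxE unit_s.
exists (point_of hZ).
  split.
  - apply/markoff_point_of; apply: on_markoff_map; exact: markoff_vecP.
  - by move=> s os; apply: mult; apply: contra_eq_neq os => ->; rewrite ow.
  - move=> s w' os; have [es|si] := eqVneq s i; last first.
      by exists (Some 0%N); [exact: mult | case: kind => //=; left].
    rewrite es ow in os; case: os => <-.
    exists (Some (w * e.+1)%N).
      rewrite es; apply: boundary_multiplicity_point_of.
      + exists (k%:R * g%:R ^+ w); rewrite mxE markoff_vec0 -q_def.
        by rewrite (intrM _ k%:Z q) eq' mulrA.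
      + exists ((k%:Z ^+ 2 + 1)%:~R * g%:R ^+ w).
        by rewrite mxE markoff_vecE eqxx -q_def intrM eq' mulrC mulrA.
      + exists (k%:R^-1 * (g%:R ^+ w)^-1), 0.
        rewrite mul0r addr0 mxE markoff_vec0 -q_def intrM eq'.
        rewrite -!mulrA (mulrCA (g%:R ^+ w)^-1) mulKr // mulKr // unitrX //.
    case: kind => /=; last exact: dvdn_mulr.
    by right; rewrite leq_pmulr.
have e' := map_mx_intr (padic_of_int p) a.
have hQ' : primitive (padic p) (map_mx (padic_of_int p) (map_mx intr a)) by rewrite e'.
rewrite (proj3_map_point_of hZ hQ'); apply: (@point_of_eq _ _ _ _ _ 1); first exact: unitr1.
by rewrite scale1r e'.
Qed.

End LocalMultiplicity.

Lemma scale_map_mxE (A B : comUnitRingType) (f : A -> B) (c : B) (a : 'rV[A]_4) t :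
  (c *: map_mx f a) 0 t = c * f (a 0 t).
Proof. by rewrite !mxE. Qed.

Lemma affine_row0 (A : comUnitRingType) (u : 'rV[A]_3) :
  (row_mx 1%:M u : 'rV[A]_4) 0 ord0 = 1.
Proof.
have e : @row_mx A 1 1 3 1%:M u 0 (lshift 3 ord0) = 1 by rewrite row_mxEl mxE eqxx.
by have -> : (ord0 : 'I_4) = @lshift 1 3 ord0; [exact: val_inj | exact: e].
Qed.

Lemma affine_rowS (A : comUnitRingType) (u : 'rV[A]_3) s :
  (row_mx 1%:M u : 'rV[A]_4) 0 (coord_index s) = u 0 s.
Proof.
have e : @row_mx A 1 1 3 1%:M u 0 (rshift 1 s) = u 0 s by rewrite row_mxEr.
by have -> : coord_index s = @rshift 1 3 s; [exact: val_inj | exact: e].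
Qed.

Lemma ord4P (t : 'I_4) : t = ord0 \/ exists s, t = coord_index s.
Proof. by case: (unliftP ord0 t) => [s ->|->]; [right; exists s | left]. Qed.

Lemma affine_markoffE (A : comUnitRingType) m (u : 'rV[A]_3) :
  affine_markoff m u <-> on_markoff m (row_mx 1%:M u : 'rV[A]_4).
Proof.
rewrite /on_markoff affine_row0 mul1r expr1n mulr1 /affine_markoff.
have -> : \sum_i (row_mx 1%:M u : 'rV[A]_4) 0 (coord_index i) ^+ 2 = \sum_i u 0 i ^+ 2.
  by apply: eq_bigr => i _; rewrite affine_rowS.
have -> // : \prod_i (row_mx 1%:M u : 'rV[A]_4) 0 (coord_index i) = \prod_i u 0 i.
by apply: eq_bigr => i _; rewrite affine_rowS.
Qed.

(** * Integral points and neighbourhoods at a prime *)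

Section PadicPoints.
Variables (p : prime_nat) (m : int).
Local Notation Zp := (padic_int p).
Local Notation Qp := (padic p).
Local Notation iota := (padic_of_int p).

Definition integral_coords (x : proj3 Qp) : Prop :=
  hcoord x 0 ord0 != 0 /\
  forall s, exists z, hcoord x 0 (coord_index s) = iota z * hcoord x 0 ord0.

Lemma affine_ZpP (x : proj3 Qp) :
  affine_Zp m p x <-> markoff_points m Qp x /\ integral_coords x.
Proof.
split=> [[u mu <-]|[mx [x0 xs]]].
  have [c cU ec] := hcoord_map iota (affine_point u).
  have [c' c'U ec'] := hcoord_point_of (primitive_affine u).
  have e : hcoord (proj3_map iota (affine_point u)) =
           (c * iota c') *: map_mx iota (row_mx 1%:M u : 'rV[Zp]_4).
    by rewrite ec -[hcoord _]/(hcoord (point_of _)) ec' map_mxZ scalerA.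
  have cc : c * iota c' \is a GRing.unit by rewrite unitrM cU rmorph_unit.
  split.
    rewrite /markoff_points /= -/(on_markoff m _) e; apply/on_markoffZ => //.
    by apply: on_markoff_map; apply/affine_markoffE.
  split; first by rewrite e scale_map_mxE affine_row0 rmorph1 mulr1 -unitfE.
  move=> s; exists (u 0 s).
  by rewrite e !scale_map_mxE affine_row0 affine_rowS rmorph1 mulr1 mulrC.
have /choice[z ez] := xs.
pose u : 'rV[Zp]_3 := \row_s z s.
have e : hcoord x = hcoord x 0 ord0 *: map_mx iota (row_mx 1%:M u : 'rV[Zp]_4).
  apply/rowP => t; rewrite scale_map_mxE; case: (ord4P t) => [->|[s ->]].
    by rewrite affine_row0 rmorph1 mulr1.
  by rewrite affine_rowS mxE ez mulrC.
have x0U : hcoord x 0 ord0 \is a GRing.unit by rewrite unitfE.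
exists u.
  apply/affine_markoffE; apply: (on_markoff_map_inj (@padic_of_int_inj p)).
  apply/(on_markoffZ m _ x0U); rewrite -e; exact: mx.
rewrite -[RHS]point_of_hcoord -[affine_point u]/(point_of _).
rewrite (proj3_map_point_of _ (primitive_map iota (primitive_affine u))).
apply: (@point_of_eq _ _ _ _ _ (hcoord x 0 ord0)^-1); first by rewrite unitrV.
by rewrite e scalerA; rewrite -e mulVr // scale1r.
Qed.

Lemma affine_Zp_semi_integral omega kind :
  affine_Zp m p `<=` semi_integral_Zp m omega kind p.
Proof.
move=> _ [u mu <-]; exists (affine_point u) => //.
have mult s : boundary_multiplicity s (affine_point u) (Some 0%N).
  by apply: boundary_multiplicity0; left; rewrite affine_row0 unitr1.
split=> //.
  by apply/markoff_point_of/affine_markoffE.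
by move=> i w _; exists (Some 0%N) => //; case: kind => /=; [left | exact: dvdn0].
Qed.

Lemma affine_Zp_open_points : affine_Zp m p `<=` open_points m Qp.
Proof. by move=> x /affine_ZpP[mx [x0 _]]. Qed.

Lemma padic_ball_open (x : Qp) n : open (padic_ball x n).
Proof.
move=> y [z yz]; exists n => t [z' tz]; exists (z' + z).
by rewrite rmorphD mulrDr -tz -yz; ring.
Qed.

Lemma padic_ball_nbhs (x : Qp) n : nbhs x (padic_ball x n).
Proof.
apply: open_nbhs_nbhs; split; first exact: padic_ball_open.
by exists 0; rewrite subrr rmorph0 mulr0.
Qed.

(** Provides the radius [p^N] of a ball whose elements are small relative to [x]. *)
Lemma padic_exp_multiple (x : Qp) n : x != 0 ->
  exists N z, p%:R ^+ N = p%:R ^+ n * iota z * x.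
Proof.
move=> x0; have [a [b [u [uU e]]]] := padic_factor x0.
exists (n + a)%N, (p%:R ^+ b * u^-1).
have -> : p%:R ^+ n * iota (p%:R ^+ b * u^-1) * x = p%:R ^+ n * iota u^-1 * (x * p%:R ^+ b).
  by rewrite rmorphM rmorphXn rmorph_nat; ring.
by rewrite e exprD -!mulrA (mulrCA (iota _)) -rmorphM mulVr // rmorph1 mulr1.
Qed.

(** In the affine coordinate [u_s = x_s / x_0] this reads [al u_s = be] modulo [p^N]. The values 1,
    0, 0 of [al], [be], [N] express that [u_s] is integral. *)
Definition close_coords (s : 'I_3) (al be : int) N : set (proj3 Qp) :=
  [set x | hcoord x 0 ord0 != 0 /\
    exists z, al%:~R * hcoord x 0 (coord_index s) - be%:~R * hcoord x 0 ord0
              = p%:R ^+ N * iota z * hcoord x 0 ord0].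

Lemma close_coords_open s al be N : open (close_coords s al be N).
Proof.
pose V := [set a : 'rV[Qp]_4 | a 0 ord0 != 0 /\ exists z,
  al%:~R * a 0 (coord_index s) - be%:~R * a 0 ord0 = p%:R ^+ N * iota z * a 0 ord0].
(* The condition is invariant under scaling, so in the quotient topology openness can be checked on
   vectors. *)
have VZ c a : c != 0 -> V (c *: a) <-> V a.
  move=> c0; rewrite /V /= !mxE mulf_eq0 negb_or c0 /=; split=> -[a0 [z e]]; split=> //; exists z.
    apply: (mulfI c0); rewrite mulrBr !mulrA ![c * _]mulrC -!mulrA e; ring.
  by rewrite !(mulrCA _ c) -mulrBr e; ring.
have WV : @proj3_of Qp @^-1` close_coords s al be N = set_val @^-1` V.
  apply/seteqP; split => a /=; have [c cU e] := hcoord_proj3_of a;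
    rewrite /close_coords /= -/(V _) e => h; first by apply/(VZ c); rewrite -?unitfE.
  by apply/VZ; rewrite -?unitfE.
suff oV : open V by rewrite /open /= /proj3_open /= WV; exists V.
rewrite openE => a [a0 [z e]].
(* The radius is taken relative to [a_0]: moving by a multiple of [p^M] multiplies [a_0] by a unit
   [v] and changes the linear form by a multiple of [p^(N+1) a_0]. *)
have [M [y ey]] := padic_exp_multiple N.+1 a0.
exists (fun _ t => padic_ball (a 0 t) M); first by move=> i t; rewrite ord1; exact: padic_ball_nbhs.
move=> b hb; have [z0 e0] := hb 0 ord0; have [zs es] := hb 0 (coord_index s).
rewrite ey in e0 es.
pose v := 1 + p%:R * (p%:R ^+ N * y * z0).
have vU : v \is a GRing.unit := unit_1Dp _.
have eb0 : b 0 ord0 = a 0 ord0 * iota v.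
  rewrite -[b 0 ord0](subrK (a 0 ord0)) e0 /v rmorphD rmorph1 !rmorphM rmorphXn rmorph_nat exprS.
  ring.
have ebs : b 0 (coord_index s) = a 0 (coord_index s) + p%:R ^+ N.+1 * iota y * a 0 ord0 * iota zs.
  by rewrite -es addrC subrK.
split; first by rewrite eb0 mulf_neq0 // -unitfE rmorph_unit.
exists ((z + p%:R * (al%:~R * y * zs - be%:~R * y * z0)) * v^-1).
have -> : p%:R ^+ N * iota ((z + p%:R * (al%:~R * y * zs - be%:~R * y * z0)) * v^-1) * b 0 ord0 =
   p%:R ^+ N * iota (z + p%:R * (al%:~R * y * zs - be%:~R * y * z0)) * a 0 ord0.
  by rewrite eb0 rmorphM -!mulrA (mulrCA (iota _^-1)) -rmorphM mulVr // rmorph1 mulr1.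
rewrite eb0 ebs /v !(rmorphD, rmorphB, rmorph1).
have eM : iota (p%:R * (p%:R ^+ N * y * z0)) = p%:R * (p%:R ^+ N * iota y * iota z0).
  by rewrite !rmorphM rmorphXn rmorph_nat.
have eM2 : iota (p%:R * (al%:~R * y * zs - be%:~R * y * z0)) =
   p%:R * (al%:~R * iota y * iota zs - be%:~R * iota y * iota z0).
  by rewrite rmorphM rmorph_nat rmorphB !rmorphM !rmorph_int.
rewrite eM eM2 exprS; move/eqP: e; rewrite subr_eq => /eqP e.
have -> : al%:~R * (a 0 (coord_index s) + p%:R * p%:R ^+ N * iota y * a 0 ord0 * iota zs) =
  al%:~R * a 0 (coord_index s) + al%:~R * (p%:R * p%:R ^+ N * iota y * a 0 ord0 * iota zs) by ring.
by rewrite e; ring.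
Qed.

(** * Rational points under the local conditions *)

Section RationalPoints.
Variables (R : realType) (M : proj3 rat).
Local Notation u s := (hcoord M 0 (coord_index s) / hcoord M 0 ord0).
Local Notation MQ := (rational_at R (Some p) M : proj3 Qp).

Lemma rational_coords : exists2 c, c != 0 &
  forall t, hcoord MQ 0 t = c * padic_of_rat p (hcoord M 0 t).
Proof.
have [c cU e] := hcoord_map (rat_completion R (Some p)) M.
by exists c; [rewrite -unitfE | move=> t; rewrite /rational_at e scale_map_mxE].
Qed.

Lemma rational_coord_close s (al be : int) N :
  close_coords s al be N MQ ->
  hcoord M 0 ord0 != 0 /\ exists z, al%:~R * padic_of_rat p (u s) - be%:~R = p%:R ^+ N * iota z.
Proof.
have [c c0 e] := rational_coords; rewrite /close_coords /= !e mulf_eq0 negb_or c0 fmorph_eq0 /=.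
move=> [x0 [z ez]]; split=> //; exists z; rewrite fmorph_div.
have x0' : c * padic_of_rat p (hcoord M 0 ord0) != 0 by rewrite mulf_neq0 // fmorph_eq0.
apply: (mulIf x0'); rewrite -ez mulrBl; congr (_ - _).
rewrite -mulrA; congr (_ * _); rewrite mulrCA -mulrA; congr (c * _).
by rewrite mulVf ?fmorph_eq0 ?mulr1.
Qed.

Lemma affine_Zp_rational : affine_Zp m p MQ -> hcoord M 0 ord0 != 0 /\
  exists2 v : 'rV[Zp]_3, affine_markoff m v & forall s, padic_of_rat p (u s) = iota (v 0 s).
Proof.
have [c c0 e] := rational_coords; move=> [v mv ev].
have [c' cU ec] := hcoord_map iota (affine_point v).
have [c'' c''U ec'] := hcoord_point_of (primitive_affine v).
have e' t : c * padic_of_rat p (hcoord M 0 t) = c' * iota c'' * iota ((row_mx 1%:M v : 'rV[Zp]_4) 0 t).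
  rewrite -e -ev ec -[affine_point v]/(point_of _) ec' scale_map_mxE.
  by rewrite -mulrA -rmorphM; congr (_ * iota _); rewrite mxE.
have e0 := e' ord0; rewrite affine_row0 rmorph1 mulr1 in e0.
have cc : c' * iota c'' != 0 by rewrite -unitfE unitrM cU rmorph_unit.
have x0 : hcoord M 0 ord0 != 0.
  by apply: contraNneq cc => x0; rewrite -e0 x0 rmorph0 mulr0.
split=> //; exists v => // s.
rewrite fmorph_div; apply: (canLR (mulfK _)); first by rewrite fmorph_eq0.
by apply: (mulfI c0); rewrite e' affine_rowS mulrCA -e0; ring.
Qed.

Lemma padic_of_rat_numden (q : rat) :
  padic_of_rat p q * (denq q)%:~R = (numq q)%:~R.
Proof. by rewrite -[in LHS](rmorph_int (padic_of_rat p)) -rmorphM -numqE rmorph_int. Qed.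

Lemma rat_close_dvd (q : rat) (al be : int) N z :
  al%:~R * padic_of_rat p q - be%:~R = p%:R ^+ N * iota z ->
  ((p ^ N)%N%:Z %| al * numq q - be * denq q)%Z.
Proof.
move=> e; apply: (@padic_int_dvd p _ N (z * (denq q)%:~R)).
apply: (@padic_of_int_inj p); rewrite rmorph_int intrB !intrM -padic_of_rat_numden.
rewrite mulrA -mulrBl e rmorphM rmorphXn rmorph_nat rmorphM rmorph_int; ring.
Qed.

Lemma padic_rat_integral (q : rat) y : padic_of_rat p q = iota y -> ~~ (p %| `|denq q|)%N.
Proof.
move=> e; apply/negP => pd.
have pn : (p%:Z %| numq q)%Z.
  have /dvdzP[c ec] : (p%:Z %| denq q)%Z by [].
  have := @padic_int_dvd p (numq q) 1 (y * c%:~R); rewrite expn1; apply.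
  apply: (@padic_of_int_inj p); rewrite rmorph_int -padic_of_rat_numden e ec.
  by rewrite intrM -pmulrn expr1 !rmorphM rmorph_nat rmorph_int; ring.
have := coprime_num_den q; rewrite /coprime => /eqP g1.
have : (p %| 1)%N by rewrite -g1 dvdn_gcd pd andbT.
by rewrite dvdn1 => /eqP p1; have := prime_natP p; rewrite p1.
Qed.

Lemma affine_Zp_split (i : 'I_3) : affine_Zp m p MQ ->
  ~~ (p %| `|denq (u i - 2)|)%N /\
  ((p %| `|numq (u i - 2)|)%N -> exists s : nat, (p%:Z %| s%:Z ^+ 2 - (m - 4))%Z).
Proof.
move=> /affine_Zp_rational[x0 [v mv ev]].
have [j [l [ji li lj all]]] := ord3_others i.
have ea : padic_of_rat p (u i - 2) = iota (v 0 i - 2).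
  by rewrite (rmorphB (padic_of_rat p)) /= ev (rmorphB iota) !rmorph_nat.
have dU := padic_rat_integral ea; split=> // pn.
have /dvdzP[c ec] : (p%:Z %| numq (u i - 2))%Z by [].
have dU' := int_unit dU.
have ev2 : v 0 i - 2 = p%:R * (c%:~R / (denq (u i - 2))%:~R).
  apply: (mulIr dU'); apply: (@padic_of_int_inj p).
  rewrite rmorphM -ea rmorph_int padic_of_rat_numden ec -mulrA divrK //.
  by rewrite intrM -pmulrn (rmorphM iota) rmorph_nat rmorph_int mulrC.
move: mv; rewrite /affine_markoff (big_ord3 _ _ ji li lj all) (big_ord3 _ _ ji li lj all) /= => mv.
(* Modulo a prime dividing [u_i - 2], the identity leaves [m - 4 = (u_j - u_l)^2]; [s] is the
   residue of [u_j - u_l]. *)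
have [t et] := residue_approx (v 0 j - v 0 l) 1.
set s := residue _ _ in et; exists s.
set y := c%:~R / _ in ev2.
have := @padic_int_dvd p (s%:Z ^+ 2 - (m - 4)) 1
   (- t * (v 0 j - v 0 l + s%:R) - y * (v 0 i + 2 - v 0 j * v 0 l)).
rewrite expn1; apply.
have -> : (s%:Z ^+ 2 - (m - 4))%:~R = s%:R ^+ 2 - (m%:~R - 4) :> Zp.
  by rewrite !rmorphB /= rmorphXn.
rewrite -mv expr1.
have et' : (s%:R : Zp) = v 0 j - v 0 l - p%:R * t by rewrite et expr1 addrK.
have -> : p%:R * (- t * (v 0 j - v 0 l + s%:R) - y * (v 0 i + 2 - v 0 j * v 0 l)) =
  - (p%:R * t) * (v 0 j - v 0 l + s%:R) - (p%:R * y) * (v 0 i + 2 - v 0 j * v 0 l) by ring.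
rewrite -ev2 et'; ring.
Qed.

End RationalPoints.
End PadicPoints.

(** The root [y = x / f] of [d] is integral, since a negative valuation would make the square of a
    unit divisible by [p]; it is then truncated modulo [p^3]. *)
Lemma padic_square_mod (p : prime_nat) (d f : int) (x : padic p) : f != 0 -> d != 0 ->
  x ^+ 2 = (f ^+ 2 * d)%:~R -> exists s : nat, ((p ^ 3)%N%:Z %| s%:Z ^+ 2 - d)%Z.
Proof.
move=> f0 d0 ex.
have f0' : (f%:~R : padic p) != 0 by rewrite intr_padic_eq0.
have [y ey] : exists y : padic p, y ^+ 2 = d%:~R.
  exists (x / f%:~R); rewrite exprMn ex intrM -[f ^+ 2]/(f * f) intrM exprVn expr2.
  by rewrite mulrAC divff ?mul1r // mulf_neq0.
have y0 : y != 0.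
  by apply: contraTneq d0 => y0; rewrite -(intr_padic_eq0 p) -ey y0 expr0n negbK.
have [a [b [u [uU e]]]] := padic_factor y0.
have [z ez] : exists z, y = padic_of_int p z.
  have [ba|ab] := leqP b a.
    exists (p%:R ^+ (a - b) * u).
    apply: (mulIf (expf_neq0 b (natr_padic_neq0 p))).
    rewrite e rmorphM rmorphXn rmorph_nat mulrAC -exprD subnK //.
  exfalso; have : d%:~R * p%:R ^+ ((b - a) * 2) = u ^+ 2.
    apply: (@padic_of_int_inj p).
    apply: (mulIf (expf_neq0 (a * 2) (natr_padic_neq0 p))).
    rewrite rmorphM rmorphXn rmorph_nat rmorph_int rmorphXn -mulrA -exprD -mulnDl subnK ?(ltnW ab) //.
    by rewrite exprM -ey -exprMn e exprMn -exprM mulrC.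
  have /subnSK <- := ab; rewrite mulSn addSn exprS mulrCA -{1}[p%:R]expr1 => /esym/dvd_residue.
  by have /padic_unitP := unitrX 2 uU.
have ez2 : z ^+ 2 = d%:~R by apply: (@padic_of_int_inj p); rewrite rmorphXn -ez ey rmorph_int.
have [t et] := residue_approx z 3; exists (z 3%N).
apply: (@padic_int_dvd p _ 3 (- t * (z + (z 3%N)%:R))).
have -> : ((z 3)%:Z ^+ 2 - d)%:~R = (z 3%N)%:R ^+ 2 - d%:~R :> padic_int p.
  by rewrite rmorphB /= rmorphXn.
have es : (z 3%N)%:R = z - p%:R ^+ 3 * t by rewrite {2}et addrK.
rewrite -ez2 es; ring.
Qed.

(** * The real place *)

Section RealPlace.
Variable R : realType.

(** The condition [u_i > 2], that is [a > 0], as linear inequalities on either sign of the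
    representative. *)
Definition ratio_gt2 (i : 'I_3) : set (proj3 R^o) := [set x |
  let a := hcoord x in let x0 : R := a 0 ord0 in let y : R := a 0 (coord_index i) in
  (0 < x0 /\ 2 * x0 < y) \/ (x0 < 0 /\ y < 2 * x0)].

Lemma ratio_gt2_open i : open (ratio_gt2 i).
Proof.
pose V := [set a : 'rV[R^o]_4 |
  let x0 : R := a 0 ord0 in let y : R := a 0 (coord_index i) in
  (0 < x0 /\ 2 * x0 < y) \/ (x0 < 0 /\ y < 2 * x0)].
have V1 (c : R) a : V a -> c != 0 -> V (c *: a).
  rewrite /V /= !mxE => h c0.
  move: (a 0 ord0 : R) (a 0 (coord_index i) : R) h => x y.
  have [cp|cn|ce] := ltgtP c 0; last by rewrite ce eqxx in c0.
    move=> [[h1 h2]|[h1 h2]]; [right|left]; split; rewrite ?[_ *: _]/(c * _).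
    - by rewrite nmulr_rlt0.
    - by rewrite mulrCA ltr_nM2l.
    - by rewrite nmulr_rgt0.
    - by rewrite mulrCA ltr_nM2l.
  move=> [[h1 h2]|[h1 h2]]; [left|right]; split.
  - by rewrite pmulr_rgt0.
  - by rewrite mulrCA ltr_pM2l.
  - by rewrite pmulr_rlt0.
  - by rewrite mulrCA ltr_pM2l.
have VZ (c : R) a : c != 0 -> V (c *: a) <-> V a.
  move=> c0; split=> h; last exact: V1.
  by rewrite -[a](scalerK c0); apply: V1; rewrite ?invr_eq0.
have WV : @proj3_of R^o @^-1` ratio_gt2 i = set_val @^-1` V.
  apply/seteqP; split => a /=; have [c cU e] := hcoord_proj3_of a;
    rewrite /ratio_gt2 /= -/(V _) e => h; first by apply/(VZ c); rewrite -?unitfE.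
  by apply/VZ; rewrite -?unitfE.
suff oV : open V by rewrite /open /= /proj3_open /= WV; exists V.
rewrite openE => a ha.
have ballN (x : R^o) (e : R) : 0 < e -> nbhs x [set y : R^o | `|x - y| < e].
  by move=> e0; exists e.
case: ha => -[h1 h2].
  (* The first bound keeps the sign of [x_0]; in the second, [x_i - 2 x_0] moves by less than
     [3 e]. *)
  pose e : R := Num.min (a 0 ord0 : R) (((a 0 (coord_index i) : R) - 2 * (a 0 ord0 : R)) / 3).
  have e0 : 0 < e by rewrite lt_min h1 divr_gt0 // subr_gt0.
  exists (fun _ t => [set y : R^o | `|a 0 t - y| < e]).
    by move=> ? t; rewrite ord1; exact: ballN.
  move=> b hb; have := hb 0 ord0; have := hb 0 (coord_index i); rewrite /V /= !ltr_norml.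
  have h3 : e <= (a 0 ord0 : R) by rewrite ge_min lexx.
  have h4 : e <= ((a 0 (coord_index i) : R) - 2 * (a 0 ord0 : R)) / 3 by rewrite ge_min lexx orbT.
  clear hb; move: e e0 h3 h4 => e e0 h3 h4.
  move: (a 0 ord0 : R) (a 0 (coord_index i) : R) (b 0 ord0 : R) (b 0 (coord_index i) : R) h1 h2 h3 h4 => x y x' y'.
  move=> h1 h2 h3 h4 /andP[h5 h6] /andP[h7 h8]; left; split; lra.
pose e : R := Num.min (- (a 0 ord0 : R)) ((2 * (a 0 ord0 : R) - (a 0 (coord_index i) : R)) / 3).
have e0 : 0 < e by rewrite lt_min oppr_gt0 h1 divr_gt0 // subr_gt0.
exists (fun _ t => [set y : R^o | `|a 0 t - y| < e]).
  by move=> ? t; rewrite ord1; exact: ballN.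
move=> b hb; have := hb 0 ord0; have := hb 0 (coord_index i); rewrite /V /= !ltr_norml.
have h3 : e <= - (a 0 ord0 : R) by rewrite ge_min lexx.
have h4 : e <= (2 * (a 0 ord0 : R) - (a 0 (coord_index i) : R)) / 3 by rewrite ge_min lexx orbT.
clear hb; move: e e0 h3 h4 => e e0 h3 h4.
move: (a 0 ord0 : R) (a 0 (coord_index i) : R) (b 0 ord0 : R) (b 0 (coord_index i) : R) h1 h2 h3 h4 => x y x' y'.
move=> h1 h2 h3 h4 /andP[h5 h6] /andP[h7 h8]; right; split; lra.
Qed.

Lemma ratio_gt2_rational i (M : proj3 rat) :
  ratio_gt2 i (rational_at R None M : proj3 R^o) ->
  2 < hcoord M 0 (coord_index i) / hcoord M 0 ord0.
Proof.
have [c cU e] := hcoord_map (rat_completion R None) M.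
rewrite /ratio_gt2 /= /rational_at e !scale_map_mxE /=.
set x := hcoord M 0 ord0; set y := hcoord M 0 _ => h.
have c0 : (c : R) != 0 by rewrite -unitfE.
have h' : ((0 < c * ratr x /\ 2 * (c * ratr x) < c * ratr y) \/
          (c * ratr x < 0 /\ c * ratr y < 2 * (c * ratr x)))%R by exact: h.
have e2 : (ratr (y / x) : R) = (c * ratr y) / (c * ratr x).
  by rewrite invfM mulrACA divff // mul1r fmorph_div.
rewrite -(ltr_rat R) rmorph_nat e2; case: h' => -[h1 h2].
  by rewrite ltr_pdivlMr.
by rewrite ltr_ndivlMr.
Qed.

End RealPlace.

(** * The adelic open set *)

Lemma integral_coords_open (p : prime_nat) : open [set x | @integral_coords p x].
Proof.
have [j [l [_ _ _ all]]] := ord3_others ord0.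
have VE s (x : proj3 (padic p)) :
    (exists z, 1%:~R * hcoord x 0 (coord_index s) - 0%:~R * hcoord x 0 ord0
              = p%:R ^+ 0 * padic_of_int p z * hcoord x 0 ord0) <->
    exists z, hcoord x 0 (coord_index s) = padic_of_int p z * hcoord x 0 ord0.
  by split=> -[z e]; exists z; move: e; rewrite expr0 !mul1r mul0r subr0.
pose V s := @close_coords p s 1 0 0.
have -> : [set x | @integral_coords p x] = V ord0 `&` (V j `&` V l).
  apply/seteqP; split => x /=.
    by move=> [x0 xs]; split; [|split]; split=> //; apply/VE.
  move=> [[x0 /VE h0] [[_ /VE hj] [_ /VE hl]]]; split=> // s.
  by case: (all s) => ->.
apply: openI; first exact: close_coords_open.
by apply: openI; exact: close_coords_open.
Qed.

(** Integrality is an open condition on strict semi-integral points, so integral points are an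
    admissible factor of a box. *)
Lemma affine_Zp_box (p : prime_nat) m omega kind : affine_Zp m p =
  (semi_integral_Zp m omega kind p `&` open_points m (padic p)) `&` [set x | @integral_coords p x].
Proof.
apply/seteqP; split => x.
  move=> hx; split; last by case/affine_ZpP: hx.
  by split; [exact: affine_Zp_semi_integral hx | exact: affine_Zp_open_points hx].
by move=> [[_ [mx _]] ix]; apply/affine_ZpP.
Qed.

Lemma intr_completion_eq0 (R : realType) (v : place) (k : int) :
  ((k%:~R : completion R v) == 0) = (k == 0).
Proof. by case: v => [p|]; [exact: intr_padic_eq0 | exact: (@intr_eq0 R)]. Qed.

Lemma restricted_box_open (R : realType) m omega kind T
    (B : forall v : place_off T, set (local_points R v)) :
  @restricted_box R m omega kind T B ->
  open [set x : strict_part R m omega kind T | forall v, B v (set_val x v)].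
Proof.
move=> hB; set O := (X in open X).
exists [set O]; last by rewrite bigcup_set1.
by move=> _ ->; apply: (@finI_from1 _ _ _ id); exists B.
Qed.

(** A box is open in the strict part, hence in the coproduct, so density puts a rational point in it
    as soon as it is non-empty. *)
Lemma strong_approximation_box (R : realType) m omega kind T
    (B : forall v : place_off T, set (local_points R v)) :
  strong_approximation R m omega kind T ->
  @restricted_box R m omega kind T B ->
  (exists x : local_families R T, forall v, B v (x v)) ->
  exists M, forall v : place_off T, B v (rational_at R (val v) M).
Proof.
move=> sa hB [x Bx]; have [hB1 hB2] := hB.
have sx : strict_families m omega kind x.
  split=> [v|].
    have [W _ e] := hB1 v; have := Bx v; rewrite e; by case.
  apply: sub_finite_set hB2 => v /= hv e; apply: hv; rewrite -e; exact: Bx.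
pose y : strict_part R m omega kind T := SigSub (mem_set sx).
have oO := restricted_box_open hB; set O := (X in open X) in oO.
have := sa _ _ (@existT_open_map bool (adelic_part R m omega kind T) true O oO).
case; first by exists (existT _ true y); exists y.
move=> _ [[z Oz <-] [M _ hM]]; exists M => v.
by rewrite -(hM v); exact: Oz.
Qed.

Section LocalBoxes.
Variables (R : realType) (m : int) (omega : 'I_3 -> option nat).
Variables (kind : semi_integral_kind) (i : 'I_3) (bad : nat -> bool) (k N : nat -> nat).

(** At a bad prime the closeness reads [k u_i = k^2 + 1] modulo [p^N]: [u_i] near [k + 1/k], without
    division by [k]. *)
Definition local_box (v : place) : set (proj3 (completion R v)) :=
  match v with
  | Some p => if bad p then
      (semi_integral_Zp m omega kind p `&` open_points m (padic p)) `&`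
      @close_coords p i (k p)%:Z ((k p)%:Z ^+ 2 + 1) (N p)
    else affine_Zp m p
  | None => open_points m R^o `&` ratio_gt2 i
  end.
Arguments local_box : clear implicits.

Lemma local_box_restricted T : finite_set [set p : prime_nat | bad p] ->
  @restricted_box R m omega kind T (fun v => local_box (val v)).
Proof.
move=> fin; split.
  case=> -[p|] pT; rewrite /local_box /=; last by exists (ratio_gt2 i) => //; exact: ratio_gt2_open.
  case: ifP => _; first by eexists; last reflexivity; exact: close_coords_open.
  by exists [set x | @integral_coords p x]; [exact: integral_coords_open | exact: affine_Zp_box].
have fin' : finite_set (None |` (Some @` [set p : prime_nat | bad p])).
  by rewrite finite_setU; split; [exact: finite_set1 | exact: finite_image].
have := @finite_preimage _ _ _ (val : place_off T -> place) (in2W val_inj) fin'.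
apply: sub_finite_set.
case=> -[p|] pT /= h; [right|by left]; exists p => //.
by move: h; rewrite /local_box /=; case: ifP.
Qed.

(** All points lie on the conic. Away from the bad primes [k = 2] and [r = 1] give [x_0 = 6] and
    [x_i = 15]: a point integral at primes not dividing 6, with [u_i = 5/2 > 2]. *)
Lemma local_box_point w (v : place) : omega i = Some w -> (0 < w)%N ->
  (forall p : prime_nat, v = Some p -> if bad p then ~~ (p %| k p)%N && (1 < k p)%N
     else ~~ (p %| 6)%N) -> local_box v !=set0.
Proof.
move=> ow w0 hv; have [j [l [ji li lj all]]] := ord3_others i.
have hx0 (k' : nat) (r : int) : (1 < k')%N -> r != 0 ->
    k'%:Z * (r * (k'%:Z ^+ 2 - 1)) != 0.
  move=> k1 r0; rewrite !mulf_neq0 //; first by lia.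
  by rewrite subr_eq0 sqrf_eq1; lia.
have prim (k' : nat) (r : int) : (1 < k')%N -> r != 0 ->
    primitive (completion R v) (map_mx intr (markoff_vec m k'%:Z r i j)).
  move=> k1 r0; exists ord0.
  by rewrite mxE markoff_vec0 unitfE intr_completion_eq0 hx0.
have onm k' r (h : primitive (completion R v) (map_mx intr (markoff_vec m k' r i j))) :
    markoff_points m (completion R v) (point_of h).
  by apply/markoff_point_of; apply: on_markoff_map; exact: markoff_vecP.
have nz0 (k' : nat) (r : int) (h : primitive (completion R v) (map_mx intr (markoff_vec m k'%:Z r i j))) :
    (1 < k')%N -> r != 0 -> hcoord (point_of h) 0 ord0 != 0.
  move=> k1 r0; have [c cU ->] := hcoord_point_of h.
  by rewrite scale_map_mxE mulf_neq0 -?unitfE // unitfE markoff_vec0 intr_completion_eq0 hx0.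
case: v hv prim onm nz0 => [p|] hv prim onm nz0; last first.
  have h := prim 2 1 isT isT; exists (point_of h); split.
    by split; [exact: onm | exact: nz0].
  have [c cU e] := hcoord_point_of h.
  have c0 : (c : R) != 0 by rewrite -unitfE.
  rewrite /ratio_gt2 /= e !scale_map_mxE markoff_vec0 markoff_vecE eqxx.
  rewrite (_ : 2%:Z * _ = 6) // (_ : 1 * (2%:Z ^+ 2 - 1) * (2%:Z ^+ 2 + 1) = 15) //.
  have H (x : R) : x != 0 ->
      (0 < x * 6 /\ 2 * (x * 6) < x * 15) \/ (x * 6 < 0 /\ x * 15 < 2 * (x * 6)).
    have [h0|h0|h0] := ltgtP x 0; last by [].

      by right; split; lra.
    by left; split; lra.
  exact: (H c c0).
have := hv p erefl; rewrite /local_box.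
case: ifP => hb hk.
  case/andP: hk => pk k1.
  pose r : int := p%:Z ^+ w * ((k p)%:Z ^+ 2 - 1) ^+ w.-1.
  have r0 : r != 0.
    rewrite mulf_neq0 ?expf_neq0 //; first by rewrite eqz_nat -lt0n prime_gt0 ?prime_natP.
    by rewrite subr_eq0 sqrf_eq1; lia.
  have h := prim (k p) r k1 r0; exists (point_of h); split.
    split; last by split; [exact: onm | exact: nz0].
    exact: (@semi_integral_markoff_vec p m omega kind i j w (k p) r h).
  split; first exact: nz0.
  exists 0; rewrite rmorph0 mulr0 mul0r.
  have [c cU ->] := hcoord_point_of h; rewrite !scale_map_mxE markoff_vec0 markoff_vecE eqxx.
  rewrite mulrCA [X in _ - X]mulrCA -mulrBr -!intrM -intrB (_ : _ - _ = 0) ?mulr0 //.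
  ring.
have h := prim 2 1 isT isT; exists (point_of h); apply/affine_ZpP; split; first exact: onm.
split; first exact: nz0.
have u6 : (6%:~R : padic_int p) \is a GRing.unit by apply: int_unit.
have [c cU ->] := hcoord_point_of h.
move=> s; exists (6%:~R^-1 * (markoff_vec m 2 1 i j 0 (coord_index s))%:~R).
rewrite !scale_map_mxE markoff_vec0 (_ : 2%:Z * _ = 6) //.
rewrite mulrCA; congr (c * _); rewrite -[X in _ = _ * X](rmorph_int (padic_of_int p)) -rmorphM.
by rewrite mulrAC mulVr // mul1r rmorph_int.
Qed.

End LocalBoxes.
Arguments local_box : clear implicits.

(** * The obstruction to strong approximation *)

Lemma finite_prime_divisors n : (0 < n)%N -> finite_set [set p : prime_nat | (p %| n)%N].
Proof.
move=> n0; have fin : finite_set `I_n.+1 := finite_II _.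
have := @finite_preimage _ _ _ nat_of_prime (in2W val_inj) fin.
by apply: sub_finite_set => p /= pn; rewrite /= ltnS dvdn_leq.
Qed.

Lemma dvdn_num_den (p : nat) (q : rat) : prime p -> (p %| `|numq q|)%N -> ~~ (p %| `|denq q|)%N.
Proof.
move=> pp pn; rewrite -prime_coprime // (coprime_dvdl pn) //; exact: coprime_num_den.
Qed.

Theorem theorem1p3 (R : realType) (m : int) (omega : 'I_3 -> option nat)
    (kind : semi_integral_kind) (T : set place) :
  m != 0 -> m != 4 ->
  ~ (exists2 r : rat, r != 0 & r ^+ 2 = (m - 4)%:~R) ->
  (forall i w, omega i = Some w -> (2 <= w)%N) ->
  (exists i, omega i <> None) ->
  finite_set T -> T `<=` split_places R m ->
  ~ strong_approximation R m omega kind T.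
Proof.
move=> _ m4 nsq hw [i oi] _ TS sa.
have [w ow] : exists w, omega i = Some w by case: (omega i) oi => // w _; exists w.
have w0 : (0 < w)%N := ltnW (hw i w ow).
have d0 : m - 4 != 0 by rewrite subr_eq0.
have [f [d [ed dn0 sfd]]] := squarefree_part d0.
have f0 : f != 0 by apply: contraNneq d0 => e; rewrite ed e expr0n mul0r.
have nsqd s : s ^+ 2 != d.
  apply/eqP => es; apply: nsq; exists (f * s)%:~R.
    rewrite intr_eq0 mulf_neq0 //; apply: contraNneq dn0 => s0.
    by rewrite -es s0 expr0n.
  by rewrite ed -es -rmorphXn exprMn.
have [D [chi chiP]] := quadratic_character_exists dn0 sfd nsqd.
have D0 := qchar_gt0 chiP.
have [k ck chik] := qchar_nontrivial chiP.
have D1 : (1 < D)%N.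
  rewrite ltnNge; apply/negP => D1; have eD : D = 1%N by lia.
  move: chik; rewrite (@qchar_mod _ _ _ chiP k 1) ?(qchar1 chiP) //.
  by rewrite eD !modn1.
have k1 : (1 < k)%N.
  case: k ck chik => [|[|//]] ck; last by rewrite (qchar1 chiP).
  by move: ck; rewrite /coprime gcd0n => /eqP eD; rewrite eD in D1.
have Tsplit p : T (Some p) -> coprime p D /\ chi p = false.
  move=> /TS[x _ ex]; have [|s hs] := @padic_square_mod p d f x f0 dn0; first by rewrite -ed.
  exact: (qchar_square chiP sfd (prime_natP p) hs).
(* Bad primes are those dividing 6, because of the point with [x_0 = 6], those dividing [D], and
   those dividing [m - 4], where a square modulo [p] does not yield splitting. *)
pose Q := (6 * D * absz (m - 4)%R)%N.
have Q0 : (0 < Q)%N by rewrite !muln_gt0 D0 absz_gt0.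
pose bad p := (p %| Q)%N; pose h := k.-1.
(* At primes dividing [D], [a] is to be near [h^2 / k]. At the other bad primes [k] is replaced by
   [p + 1]: then [a] is near [p^2 / (p + 1)], and the precision [p^3] fixes its valuation at 2. *)
pose kp p := if (p %| D)%N then k else p.+1.
pose Np p := if (p %| D)%N then logn p (D * h ^ 2) else 3%N.
have rbox := @local_box_restricted R m omega kind i bad kp Np T (finite_prime_divisors Q0).
have point (v : place_off T) : local_box R m omega kind i bad kp Np (val v) !=set0.
  apply: (@local_box_point R m omega kind i bad kp Np w _ ow w0) => p _; have pp := prime_natP p.
  case: ifP => [_|/negbT]; last first.
    by apply: contra => p6; rewrite /bad /Q -mulnA dvdn_mulr.
  rewrite /kp; case: ifP => pD.
    rewrite k1 andbT; apply/negP => pk.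
    have : coprime p D by apply: coprime_dvdl ck.
    by rewrite prime_coprime // pD.
  rewrite ltnS prime_gt0 // andbT -addn1 dvdn_addr // dvdn1.
  by apply: contraTneq pp => ->.
have [|M hM] := strong_approximation_box sa rbox.
  by exists (fun v => projT1 (cid (point v))) => v; exact: (projT2 (cid (point v))).
have hMv v : ~ T v -> local_box R m omega kind i bad kp Np v (rational_at R v M).
  move=> nT; exact: (hM (SigSub (mem_set (nT : (~` T) v)))).
pose u : rat := hcoord M 0 (coord_index i) / hcoord M 0 ord0.
pose a := u - 2.
have h0 : (0 < h)%N by rewrite /h; lia.
(* Subtracting [2 k] turns [k u_i = k^2 + 1] into [k a = (k - 1)^2]. *)
have hclose (p : prime_nat) : ~ T (Some p) -> bad p ->
    ((p ^ Np p)%N%:Z %| (kp p)%:Z * numq a - ((kp p).-1 ^ 2)%N%:Z * denq a)%Z.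
  move=> nT bp; have := hMv _ nT; rewrite /local_box bp => -[_ /rational_coord_close[_ [z ez]]].
  have kp0 : (0 < kp p)%N by rewrite /kp; case: ifP => // _; lia.
  apply: (@rat_close_dvd p a _ _ _ z); rewrite -ez /a rmorphB rmorph_nat.
  have -> : ((kp p).-1 ^ 2)%N%:Z = (kp p)%:Z ^+ 2 + 1 - 2 * (kp p)%:Z.
    have e1 : (kp p).-1%:Z = (kp p)%:Z - 1 by move: (kp p) kp0; lia.
    by rewrite PoszX e1; ring.
  rewrite intrB intrM /= -/u; ring.
have Dbad p : prime p -> (p %| D)%N -> bad p.
  by move=> pp pD; rewrite /bad /Q -mulnA mulnCA dvdn_mulr.
have DT (p : prime_nat) : (p %| D)%N -> ~ T (Some p).
  by move=> pD /Tsplit[]; rewrite prime_coprime ?prime_natP // pD.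
have hD p : prime p -> (p %| D)%N -> ~~ (p %| `|denq a|)%N /\
     ((p ^ logn p (D * h ^ 2))%N%:Z %| k%:Z * numq a - (h ^ 2)%N%:Z * `|denq a|%N%:Z)%Z.
  move=> pp pD; pose p' : prime_nat := exist _ p pp.
  have := hclose p' (DT p' pD) (Dbad p pp pD); rewrite /kp /Np /= pD -/h => hdvd.
  have pdvd : (p%:Z %| k%:Z * numq a - (h ^ 2)%N%:Z * denq a)%Z.
    apply: dvdz_trans hdvd; rewrite dvdzE !absz_nat dvdn_exp //.
    by rewrite lognM ?expn_gt0 ?h0 // addn_gt0 logn_gt0 mem_primes pp D0 pD.
  split; last by rewrite absz_denq.
  apply/negP => pd.
  have : (p%:Z %| k%:Z * numq a)%Z.
    rewrite -[k%:Z * numq a](subrK ((h ^ 2)%N%:Z * denq a)) rpredD //.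
    by rewrite dvdz_mull.
  rewrite dvdzE abszM Euclid_dvdM // => /orP[pk|pn].
    have : coprime p D by apply: coprime_dvdl ck.
    by rewrite prime_coprime // pD.
  by have := dvdn_num_den pp pn; rewrite pd.
(* The factor [D] in the precision excludes [a = 0]: otherwise, at a prime dividing [D], [h^2] would
   be divisible by a power beyond its valuation. *)
have a0 : numq a != 0.
  apply/eqP => na0; pose p := pdiv D.
  have pp : prime p := pdiv_prime D1.
  have [pd] := hD p pp (pdiv_dvd D); rewrite na0 mulr0 sub0r dvdzE abszN abszM !absz_nat.
  rewrite pfactor_dvdn // ?muln_gt0 ?expn_gt0 ?h0 ?absz_gt0 ?denq_neq0 //.
  rewrite !lognM ?expn_gt0 ?h0 ?absz_gt0 ?denq_neq0 //.
  have -> : logn p `|denq a| = 0%N by apply/eqP; rewrite -leqn0 leqNgt logn_gt0 mem_primes pp (negbTE pd) andbF.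
  have : (0 < logn p D)%N by rewrite logn_gt0 mem_primes pp D0 pdiv_dvd.
  lia.
suff : chi k = false by rewrite chik.
apply: (qchar_reciprocity chiP ck (ltnW k1) h0 _ a0 _ hD); first by rewrite absz_gt0 denq_neq0.
(* If the real place is in [T], then [m - 4] is a real square and [d > 0]; otherwise the box gives
   [a > 0]. *)
- have [TN|nTN] := pselect (T None).
    left; have [x xn0 ex] := TS _ TN.
    have : 0 < (x : R) ^+ 2 by rewrite exprn_even_gt0.
    have -> : (x : R) ^+ 2 = (m - 4)%:~R by exact: ex.
    by rewrite ltr0z ed pmulr_rgt0 // exprn_even_gt0.
  right; rewrite numq_gt0 /a subr_gt0.
  by have := hMv _ nTN => -[_ /ratio_gt2_rational].
(* A prime of [T] splits; at a bad prime the numerator of [a] has valuation 2; at any other prime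
   both valuations vanish, or [p] divides the numerator and splits. *)
- move=> p pp pD; pose p' : prime_nat := exist _ p pp.
  have [Tp|nTp] := pselect (T (Some p')); first by left; have [] := Tsplit _ Tp.
  have logn0 n : ~~ (p %| n)%N -> logn p n = 0%N.
    by move=> pn; apply/eqP; rewrite -leqn0 leqNgt logn_gt0 mem_primes pp (negbTE pn) !andbF.
  case bp: (bad p).
    right; have := hclose p' nTp bp; rewrite /kp /Np /= (negbTE pD) /= => hdvd.
    have pA : (p ^ 2 %| `|numq a|)%N.
      have : ((p ^ 2)%N%:Z %| p.+1%:Z * numq a)%Z.
        rewrite -[p.+1%:Z * numq a](subrK ((p ^ 2)%N%:Z * denq a)) rpredD ?dvdz_mulr //.
        by apply: dvdz_trans hdvd; rewrite dvdzE !absz_nat dvdn_exp2l.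
      rewrite dvdzE abszM !absz_nat Gauss_dvdr // coprimeXl //.
      by rewrite -addn1 /coprime gcdnDl gcdn1.
    have pA1 : (p %| `|numq a|)%N by apply: dvdn_trans pA; rewrite dvdn_exp.
    have pB := dvdn_num_den pp pA1.
    rewrite (logn0 _ pB) andbT.
    have -> : logn p `|numq a| = 2%N; last by [].
    have A0 : (0 < `|numq a|)%N by rewrite absz_gt0.
    apply/eqP; rewrite eqn_leq -pfactor_dvdn // pA andbT leqNgt -pfactor_dvdn //.
    apply/negP => pA3; have : ((p ^ 3)%N%:Z %| (p ^ 2)%N%:Z * denq a)%Z.
      rewrite -(subKr (p.+1%:Z * numq a) ((p ^ 2)%N%:Z * denq a)) rpredB //.
      by rewrite dvdz_mull // dvdzE absz_nat.
    rewrite dvdzE abszM !absz_nat expnSr dvdn_pmul2l ?expn_gt0 ?prime_gt0 //.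
    exact/negP.
  have := hMv _ nTp; rewrite /local_box [bad _]bp => /affine_Zp_split -/(_ i) [pB hA].
  have [pA|pA] := boolP (p %| `|numq a|)%N; last first.
    by right; rewrite (logn0 _ pA) (logn0 _ pB).
  left; have [s hs] := hA pA.
  move/negbT: bp; rewrite /bad /Q !Euclid_dvdM // !negb_or => /andP[/andP[p6 _] pd].
  move: pd; rewrite ed abszM abszX Euclid_dvdM // Euclid_dvdX // andbT negb_or => /andP[pf pd].
  have op : odd p.
    by case: (even_prime pp) => // p2; rewrite p2 in p6.
  have [|_ //] := @qchar_split _ _ _ chiP p s `|f|%N pp op pd pf.
  have -> : `|f|%N%:Z ^+ 2 = f ^+ 2 by rewrite abszE -normrX ger0_norm ?sqr_ge0.
  by rewrite -ed.
Qed.
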